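(* Let $(\alpha,\beta,\gamma)$ be a triple of partitions with $|\alpha|=|\beta|=|\gamma|$. If $(\alpha,\beta,\gamma)$ is weakly stable, then it is stable.
   Context: For a partition $\alpha$ of $n$ (a non-increasing finite sequence of positive integers with sum $|\alpha|=n$), $M_\alpha$ denotes the corresponding complex irreducible representation of the symmetric group $\mathfrak{S}_n$. For partitions $\alpha,\beta,\gamma$ of the same integer $n$, the Kronecker coefficient $g_{\alpha,\beta,\gamma}$ is the multiplicity of $M_\gamma$ in $M_\alpha\otimes M_\beta$. Partitions are added componentwise (with $\alpha_i=0$ for $i>\ell(\alpha)$, $\ell$ denoting the number of parts), and $d\alpha=(d\alpha_1,d\alpha_2,\dots)$. A triple $(\alpha,\beta,\gamma)$ with $|\alpha|=|\beta|=|\gamma|$ is called weakly stable if $g_{d\alpha,d\beta,d\gamma}=1$ for all integers $d\geq 1$; it is called stable if $g_{\alpha,\beta,\gamma}>0$ and, for every triple $(\lambda,\mu,\nu)$ of partitions with $|\lambda|=|\mu|=|\nu|$, the sequence $(g_{\lambda+d\alpha,\mu+d\beta,\nu+d\gamma})_{d\in\mathbb{N}}$ is eventually constant. *)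

(* Defs.v *)
From mathcomp Require Import all_boot all_order all_algebra all_fingroup.
From mathcomp Require Import all_field.
Set Implicit Arguments. Unset Strict Implicit. Unset Printing Implicit Defensive.
Import Order.TTheory GRing.Theory Num.Theory.
Local Open Scope ring_scope.

Definition is_partition (l : seq nat) : bool :=
  sorted geq l && all (fun x => 0 < x)%N l.

Fixpoint padd (l m : seq nat) : seq nat :=
  match l, m with
  | [::], _ => m
  | _, [::] => l
  | x :: l', y :: m' => (x + y)%N :: padd l' m'
  end.
Definition pscale (d : nat) (l : seq nat) : seq nat := map (muln d) l.

(* (row, column) of the j-th cell (0-based) of the Young diagram of shape l,
   cells being enumerated in reading order (row by row). *)
Fixpoint cell_of (l : seq nat) (j : nat) : nat * nat :=
  match l with
  | [::] => (0%N, 0%N)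
  | a :: l' => if (j < a)%N then (0%N, j)
               else let rc := cell_of l' (j - a) in (rc.1.+1, rc.2)
  end.

Section Specht.
Variables (n : nat) (la : seq nat).

(* A tabloid is encoded by the map sending each entry x in 'I_n to the
   index of the row containing it. *)
Definition tabloid := {ffun 'I_n -> 'I_n.+1}.
Definition NT := #|{: tabloid}|.

Definition tab_act (f : tabloid) (s : 'S_n) : tabloid := [ffun x => f ((s^-1)%g x)].

Definition tab_mx (s : 'S_n) : 'M[algC]_NT :=
  \matrix_(i, j) (tab_act (enum_val i) s == enum_val j)%:R.

(* The tableau t_s places entry s j in the j-th cell (reading order).
   Its polytabloid: e_t = \sum_{p in C_t} sgn(p) {p t}. *)
Definition polytab (s : 'S_n) : 'rV[algC]_NT :=
  \sum_(p : 'S_n | [forall x : 'I_n,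
          (cell_of la ((s^-1)%g (p x))).2 == (cell_of la ((s^-1)%g x)).2])
     ((-1) ^+ p) *: delta_mx 0
        (enum_rank ([ffun x => inord (cell_of la ((s^-1)%g ((p^-1)%g x))).1] : tabloid)).

Definition specht_mx : 'M[algC]_(#|{: 'S_n}|, NT) :=
  \matrix_(i < #|{: 'S_n}|) polytab (enum_val i).

(* Character of the Specht module: trace of s acting on the row space of
   specht_mx, computed in the basis row_base specht_mx. *)
Definition specht_char (s : 'S_n) : algC :=
  let B := row_base specht_mx in \tr (B *m tab_mx s *m pinvmx B).

End Specht.
Arguments specht_char : clear implicits.

(* Multiplicity of M_c in M_a (x) M_b, computed as the character inner
   product < chi_a chi_b , chi_c > over S_n. *)
Definition kron_n (n : nat) (a b c : seq nat) : algC :=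
  (#|{: 'S_n}|%:R)^-1 *
  \sum_(g : 'S_n) specht_char n a g * specht_char n b g * (specht_char n c g)^*.

Definition kron (a b c : seq nat) : algC := kron_n (sumn a) a b c.

Definition weakly_stable (a b c : seq nat) : Prop :=
  forall d : nat, (1 <= d)%N ->
    kron (pscale d a) (pscale d b) (pscale d c) = 1.

Definition stable (a b c : seq nat) : Prop :=
  0 < kron a b c /\
  forall la mu nu : seq nat,
    is_partition la -> is_partition mu -> is_partition nu ->
    sumn la = sumn mu -> sumn mu = sumn nu ->
    exists D : nat, forall d : nat, (D <= d)%N ->
      kron (padd la (pscale d a)) (padd mu (pscale d b)) (padd nu (pscale d c))
      = kron (padd la (pscale D a)) (padd mu (pscale D b)) (padd nu (pscale D c)).

(* Main.v *)
(** The Kronecker coefficient g(la, mu, nu) is the dimension of the space R(la, mu, nu) of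
    highest weight polynomials of weight (la, mu, nu) in C[V (x) V (x) V], V = C^N, for the
    product of three copies of gl_N: both count the S_n-invariants in a tensor product of
    three Specht modules, a Specht module being the space of highest weight vectors of weight
    la in the n-th tensor power of V.

    The polynomial ring is a domain and R is multiplicative, so multiplication by a nonzero
    element of R(al, be, ga) shows that d |-> g(la + d al, mu + d be, nu + d ga) is
    non-decreasing. It remains to bound it. A highest weight polynomial is the specialization
    of a gl_N^3-invariant of a larger polynomial ring, having one more set of variables for
    each possible column of a Young diagram. By Hilbert's basis theorem the invariants of
    multidegrees (la, mu, nu) + d (al, be, ga), for d in N, lie in an ideal generated by
    finitely many of them, m_1, ..., m_k, of multidegrees indexed by d_1, ..., d_k; a Casimir
    operator plays the role of the Reynolds operator and makes the coefficients invariant. The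
    i-th coefficient then specializes into R((d - d_i)(al, be, ga)), a line by weak stability,
    and so the dimension is at most k for large d. *)

Require Import Defs.
From HB Require Import structures.
From Stdlib Require Import Classical.
From mathcomp Require Import all_boot all_order all_algebra all_fingroup all_field.
From mathcomp Require Import zify ring.
From mathcomp.multinomials Require Import mpoly.
Set Implicit Arguments. Unset Strict Implicit. Unset Printing Implicit Defensive.
Import Order.TTheory GRing.Theory Num.Theory.
Local Open Scope ring_scope.

(** * Linear algebra *)

(** The highest weight conditions involve only the E_ij with i < j, a family not closed under
    adjoints, so no argument with a self-adjoint operator applies to them directly. This is why the
    ring is enlarged: there the conditions become invariance under all E_ij, and the adjoint of E_ij
    for the Fischer product is E_ji. The added variables span tensor powers of the dual of C^N, one
    power for each column length k + 1. Setting them to the coordinates of e_0 /\ ... /\ e_k, a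
    vector killed by every E_ij with i < j, turns invariants back into highest weight polynomials.
    The numbers of columns of each length become degrees in the added variables, and degrees
    subtract when a generator is split off: la, mu, nu cancel and only a multiple of (al, be, ga)
    remains for the coefficient. *)

Section LinearAlgebra.
Variables (F : fieldType) (E : lmodType F).

Definition spanned k (b : 'I_k -> E) (u : E) : Prop :=
  exists c : 'I_k -> F, u = \sum_i c i *: b i.

Definition independent k (b : 'I_k -> E) : Prop :=
  forall c : 'I_k -> F, \sum_i c i *: b i = 0 -> forall i, c i = 0.

Definition has_dim (U : E -> Prop) (k : nat) : Prop :=
  exists b : 'I_k -> E,
    [/\ forall i, U (b i), independent b & forall u, U u -> spanned b u].

Lemma spanned_dependent r k (u : 'I_r -> E) (b : 'I_k -> E) :
  (forall i, spanned b (u i)) -> (k < r)%N ->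
  exists c : 'I_r -> F, (exists i, c i != 0) /\ \sum_i c i *: u i = 0.
Proof.
move=> /fin_all_exists [A uA] ltkr.
pose M : 'M[F]_(r, k) := \matrix_(i, j) A i j.
have ker0 : kermx M != 0.
  rewrite -mxrank_eq0 mxrank_ker -lt0n subn_gt0.
  exact: leq_ltn_trans (rank_leq_col M) ltkr.
have /rowV0Pn[v /sub_kermxP vM v0] := ker0.
exists (fun j => v 0 j); split.
  apply/existsP; apply: contraR v0; rewrite negb_exists => /forallP c0.
  by apply/eqP/rowP => j; rewrite !mxE; apply/eqP; move: (c0 j); rewrite negbK.
under eq_bigr => j _ do rewrite uA scaler_sumr.
rewrite exchange_big /= big1 // => l _.
under eq_bigr => j _ do rewrite scalerA.
rewrite -scaler_suml.
have -> : \sum_j v 0 j * A j l = (v *m M) 0 l.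
  by rewrite mxE; apply: eq_bigr => j _; rewrite !mxE.
by rewrite vM mxE scale0r.
Qed.

Lemma independent_leq r k (u : 'I_r -> E) (b : 'I_k -> E) :
  independent u -> (forall i, spanned b (u i)) -> (r <= k)%N.
Proof.
move=> indu ub; rewrite leqNgt; apply/negP => /(spanned_dependent ub).
by case=> c [[i /eqP ci] /indu/(_ i)].
Qed.

Lemma has_dim_leq_span (U : E -> Prop) r k (b : 'I_k -> E) :
  has_dim U r -> (forall u, U u -> spanned b u) -> (r <= k)%N.
Proof. by case=> u [Uu indu _] Ub; apply: independent_leq indu _ => i; apply: Ub. Qed.

(* An endomorphism T with ker T^2 = ker T satisfies E = ker T + im T locally:
   divide a linear relation among the T^i p by its lowest power of T. *)
Lemma ker_im_decomposition (T : {linear E -> E}) p k (b : 'I_k -> E) :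
  (forall x, T (T x) = 0 -> T x = 0) ->
  (forall i, spanned b (iter i T p)) ->
  exists q, T (p - T q) = 0.
Proof.
move=> kerT pb.
have [c [[i0 ci0] sum0]] : exists c : 'I_k.+1 -> F, (exists i, c i != 0) /\
    \sum_i c i *: iter i T p = 0.
  by apply: (@spanned_dependent _ _ (fun i : 'I_k.+1 => iter i T p) b).
have [j cj minj] := @arg_minnP _ i0 (fun i => c i != 0) (fun i : 'I_k.+1 => i : nat) ci0.
have iterZ i a x : iter i T (a *: x) = a *: iter i T x.
  by elim: i => //= i ->; rewrite linearZ.
have iter_sum i (f : 'I_k.+1 -> E) (P : pred 'I_k.+1) :
    iter i T (\sum_(l | P l) f l) = \sum_(l | P l) iter i T (f l).
  by elim: i => //= i ->; rewrite linear_sum.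
have iterT_D i x y : iter i T (x + y) = iter i T x + iter i T y.
  by elim: i => //= i ->; rewrite linearD.
pose q : E := \sum_(i < k.+1 | (j < i)%N) c i *: iter (i - j).-1 T p.
have T0 : iter j T (c j *: p + T q) = 0.
  rewrite -[RHS]sum0 (bigD1 j) //= iterT_D iterZ; congr (_ + _).
  rewrite -iterSr iterS /q iter_sum linear_sum /=.
  rewrite [RHS](bigID (fun i : 'I_k.+1 => (j < i)%N)) /= [X in _ = _ + X]big1 ?addr0.
    rewrite [RHS](eq_bigl (fun i : 'I_k.+1 => (j < i)%N)); last first.
      by move=> i; case: ltnP; rewrite ?andbF // andbT -val_eqE neq_ltn => ->; rewrite orbT.
    apply: eq_bigr => i ltji; rewrite iterZ linearZ /= -iterS -iterD addSnnS prednK ?subn_gt0 //.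
    by rewrite subnKC // ltnW.
  move=> i /andP[nij]; rewrite -leqNgt leq_eqVlt val_eqE (negbTE nij) /= => ltij.
  case: (eqVneq (c i) 0) => [->|ci]; first by rewrite scale0r.
  by have := minj _ ci; rewrite leqNgt ltij.
have T1 : T (c j *: p + T q) = 0.
  elim: (nat_of_ord j) T0 => [|n IHn]; first by move=> /= ->; rewrite linear0.
  case: n IHn => [_ //|n IHn] /= /kerT; exact: IHn.
exists (- (c j)^-1 *: q).
have -> : p - T (- (c j)^-1 *: q) = (c j)^-1 *: (c j *: p + T q).
  by rewrite linearZ /= scaleNr opprK scalerDr scalerA mulVf // scale1r.
by rewrite linearZ /= T1 scaler0.
Qed.

End LinearAlgebra.

Definition subspace (F : fieldType) (E : lmodType F) (U : E -> Prop) : Prop :=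
  U 0 /\ forall (a : F) x y, U x -> U y -> U (a *: x + y).

Lemma has_dim_inj (F : fieldType) (E E' : lmodType F) (U : E -> Prop) (U' : E' -> Prop)
    (f : E -> E') r k :
  (forall (a : F) x y, f (a *: x + y) = a *: f x + f y) ->
  subspace U -> (forall x, U x -> U' (f x)) ->
  (forall x, U x -> f x = 0 -> x = 0) ->
  has_dim U r -> has_dim U' k -> (r <= k)%N.
Proof.
move=> fL [U0 UL] fU finj [b [Ub indb _]] [b' [_ _ spb']].
have f0 : f 0 = 0.
  have := fL 1 0 0; rewrite !scale1r addr0 => f00.
  by apply: (addIr (f 0)); rewrite -f00 add0r.
have fsum (c : 'I_r -> F) : f (\sum_i c i *: b i) = \sum_i c i *: f (b i).
  by elim/big_rec2: _ => // i x y _ <-; rewrite fL.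
have Usum (c : 'I_r -> F) : U (\sum_i c i *: b i).
  by elim/big_rec: _ => // i x _ Ux; apply: UL.
apply: (@independent_leq _ _ r k (fun i => f (b i)) b') => [c|i]; last exact/spb'/fU.
by rewrite -fsum => /(finj _ (Usum c)) /indb.
Qed.

(** * Hilbert's basis theorem *)

(** Induct on the number of coordinates. A list good for the first [n] coordinates also serves every
    [t] whose last coordinate is at least the maximum over that list; the other [t] lie in finitely
    many slices of constant last coordinate, each covered by the induction hypothesis. *)
Lemma dickson (T : eqType) n (x : T -> nat -> nat) (S : T -> Prop) :
  exists l : seq T, (forall t, t \in l -> S t) /\
    forall t, S t -> exists2 u, u \in l & forall i, (i < n)%N -> (x u i <= x t i)%N.
Proof.
elim: n S => [|n IHn] S.
  have [[t St]|noS] := classic (exists t, S t).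
    by exists [:: t]; split=> [u|u _]; [rewrite inE => /eqP-> | exists t; rewrite ?inE].
  by exists [::]; split=> // t St; case: noS; exists t.
have [l0 [l0S l0P]] := IHn S.
have slices B : exists l : seq T, (forall t, t \in l -> S t) /\
    forall t, S t -> (x t n < B)%N ->
    exists2 u, u \in l & forall i, (i < n.+1)%N -> (x u i <= x t i)%N.
  elim: B => [|B [l [lS lP]]]; first by exists [::].
  have [l' [l'S l'P]] := IHn (fun t => S t /\ x t n = B).
  exists (l ++ l'); split=> [t|t St].
    by rewrite mem_cat => /orP[/lS|/l'S[]].
  rewrite ltnS leq_eqVlt => /orP[/eqP xtB|/(lP _ St)[u ul uP]]; last first.
    by exists u; rewrite // mem_cat ul.
  have [u ul' uP] := l'P t (conj St xtB).
  exists u => [|i]; first by rewrite mem_cat ul' orbT.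
  rewrite ltnS leq_eqVlt => /orP[/eqP->|/uP//].
  by rewrite xtB; case: (l'S _ ul') => _ ->.
have [l [lS lP]] := slices (\max_(u <- l0) x u n)%N.
exists (l0 ++ l); split=> [t|t St].
  by rewrite mem_cat => /orP[/l0S|/lS].
have [/(lP _ St)[u ul uP]|Bt] := ltnP (x t n) (\max_(u <- l0) x u n)%N.
  by exists u; rewrite // mem_cat ul orbT.
have [u ul uP] := l0P t St.
exists u => [|i]; first by rewrite mem_cat ul.
rewrite ltnS leq_eqVlt => /orP[/eqP->|/uP//].
by apply: leq_trans Bt; rewrite (leq_bigmax_seq u).
Qed.

Section HilbertBasis.
Variables (F : fieldType) (n : nat).
Implicit Types (a p q : {mpoly F[n]}).

Definition in_ideal (S : {mpoly F[n]} -> Prop) p : Prop :=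
  exists l : seq ({mpoly F[n]} * {mpoly F[n]}),
    (forall x, x \in l -> S x.2) /\ p = \sum_(x <- l) x.1 * x.2.

Lemma in_ideal0 S : in_ideal S 0.
Proof. by exists [::]; rewrite big_nil. Qed.

Lemma in_idealD S p q : in_ideal S p -> in_ideal S q -> in_ideal S (p + q).
Proof.
move=> [l [lS ->]] [l' [l'S ->]]; exists (l ++ l'); rewrite big_cat; split=> // x.
by rewrite mem_cat => /orP[/lS|/l'S].
Qed.

Lemma in_idealM S a p : in_ideal S p -> in_ideal S (a * p).
Proof.
move=> [l [lS ->]]; exists [seq (a * x.1, x.2) | x <- l]; split.
  by move=> y /mapP[x xl ->]; apply: (lS x).
by rewrite big_map mulr_sumr; apply: eq_bigr => x _; rewrite mulrA.
Qed.

Lemma in_ideal_gen S p : S p -> in_ideal S p.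
Proof.
move=> Sp; exists [:: (1, p)]; split=> [x|]; first by rewrite inE => /eqP->.
by rewrite big_seq1 mul1r.
Qed.

Lemma in_ideal_trans S S' p :
  (forall q, S q -> in_ideal S' q) -> in_ideal S p -> in_ideal S' p.
Proof.
move=> SS' [l [lS ->]]; rewrite big_seq; apply: big_ind => [|q r|x xl].
- exact: in_ideal0.
- exact: in_idealD.
- exact/in_idealM/SS'/lS.
Qed.

Lemma in_ideal_seqP (l : seq {mpoly F[n]}) p :
  in_ideal (fun q => q \in l) p ->
  exists a : 'I_(size l) -> {mpoly F[n]}, p = \sum_i a i * l`_i.
Proof.
move=> [l' [l'l ->]]; rewrite big_seq; apply: (big_ind (fun p =>
  exists a : 'I_(size l) -> {mpoly F[n]},
  p = \sum_i a i * l`_i)) => [|q r [a ->] [b ->]|x xl].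
- by exists (fun=> 0); rewrite big1 // => i _; rewrite mul0r.
- by exists (fun i => a i + b i); rewrite -big_split; apply: eq_bigr => i _; rewrite mulrDl.
- have := l'l _ xl; rewrite -index_mem => ltx.
  exists (fun i => if i == Ordinal ltx then x.1 else 0).
  rewrite (bigD1 (Ordinal ltx)) //= eqxx nth_index ?l'l // big1 ?addr0 // => i /negbTE->.
  by rewrite mul0r.
Qed.

(** Dickson's lemma for the leading exponents of the nonzero elements of the ideal gives a Groebner
    basis; division by it terminates because the leading monomial drops. Its members need not lie in
    [S], so each is finally replaced by the finitely many elements of [S] in an expression of it. *)
Theorem hilbert_basis (S : {mpoly F[n]} -> Prop) :
  exists l : seq {mpoly F[n]}, (forall g, g \in l -> S g) /\
    forall p, in_ideal S p -> in_ideal (fun q => q \in l) p.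
Proof.
have [l [lI lP]] := dickson n (fun p i => nth 0%N (mlead p) i)
  (fun p => in_ideal S p /\ p != 0).
have gen_l p : in_ideal S p -> in_ideal (fun q => q \in l) p.
  have [m lepm] : exists m, mlead p = m by exists (mlead p).
  elim/(well_founded_ind (@ltom_wf n)): m p lepm => m IHm p lepm pI.
  have [->|p0] := eqVneq p 0; first exact: in_ideal0.
  have [g gl legp] := lP p (conj pI p0).
  have [gI g0] := lI g gl.
  have {}legp : (mlead g <= mlead p)%MM.
    by apply/mnm_lepP => i; rewrite !(mnm_nth 0%N); apply: legp.
  pose a : {mpoly F[n]} := (mleadc p / mleadc g) *: 'X_[mlead p - mlead g].
  have c0 : mleadc p / mleadc g != 0 by rewrite mulf_neq0 ?invr_eq0 ?mleadc_eq0.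
  have lea : mlead a = (mlead p - mlead g)%MM by rewrite mleadZ // mleadXm.
  have a0 : a != 0 by rewrite -mleadc_eq0 lea mcoeffZ mcoeffX eqxx mulr1.
  have leh : mlead (a * g) = mlead p by rewrite mleadM // lea submK.
  have agl : in_ideal (fun q => q \in l) (a * g) by apply/in_idealM/in_ideal_gen.
  rewrite -[p](subrK (a * g)); apply: in_idealD => //.
  have [->|q0] := eqVneq (p - a * g) 0; first exact: in_ideal0.
  apply: (IHm (mlead (p - a * g))) => //; last first.
    by rewrite -mulNr; apply/in_idealD/in_idealM.
  rewrite -lepm lt_neqAle (le_trans (mleadB_le _ _)) ?leh ?joinxx // andbT.
  apply: contraNneq q0 => leq; rewrite -mleadc_eq0 leq mcoeffB.
  rewrite -[X in _ - (a * g)@_X](submK legp) -lea mleadcM lea mcoeffZ mcoeffX eqxx mulr1.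
  by rewrite divfK ?subrr // mleadc_eq0.
suff [l' [l'S l'P]] : exists l' : seq {mpoly F[n]}, (forall g, g \in l' -> S g) /\
    forall q, q \in l -> in_ideal (fun q => q \in l') q.
  by exists l'; split=> // p /gen_l; apply: in_ideal_trans.
have {lP gen_l} : forall p, p \in l -> in_ideal S p by move=> p /lI[].
elim: l {lI} => [|q l IHl] lI; first by exists [::].
have [|l' [l'S l'P]] := IHl; first by move=> p pl; apply: lI; rewrite inE pl orbT.
have [l1 [l1S ->]] := lI q (mem_head _ _).
exists (map snd l1 ++ l'); split=> [g|r].
  by rewrite mem_cat => /orP[/mapP[x xl ->]|/l'S//]; apply: l1S.
rewrite inE => /orP[/eqP->|/l'P]; last first.
  by apply: in_ideal_trans => g gl; apply: in_ideal_gen; rewrite mem_cat gl orbT.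
by exists l1; split=> // x xl; rewrite mem_cat map_f.
Qed.

End HilbertBasis.

(** * Linear vector fields and the Casimir operator *)

Section LinearVectorFields.
Variable A : finType.
Notation C := algC.
Notation R := {mpoly C[#|A|]}.
Implicit Types (p q r : R) (L : A -> A -> C).

Definition vr (a : A) : R := 'X_(enum_rank a).
Definition dr (a : A) (p : R) : R := p^`M(enum_rank a).

(* The linear vector field of the matrix [L]. *)
Definition lvf L p : R := \sum_a \sum_b L a b *: (vr a * dr b p).

Lemma lvf_is_linear L : linear (lvf L).
Proof.
move=> c p q; rewrite /lvf scaler_sumr -big_split; apply: eq_bigr => a _ /=.
rewrite scaler_sumr -big_split; apply: eq_bigr => b _ /=.
by rewrite /dr mderivD mderivZ mulrDr -scalerAr scalerDr !scalerA mulrC.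
Qed.
HB.instance Definition _ L := GRing.isLinear.Build C R R *:%R (lvf L) (lvf_is_linear L).

Lemma lvfM L p q : lvf L (p * q) = lvf L p * q + p * lvf L q.
Proof.
rewrite /lvf mulr_suml mulr_sumr -big_split; apply: eq_bigr => a _ /=.
rewrite mulr_suml mulr_sumr -big_split; apply: eq_bigr => b _ /=.
by rewrite /dr mderivM mulrDr scalerDr -scalerAl -scalerAr mulrA [p * (_ * _)]mulrCA.
Qed.

Lemma lvf1 L : lvf L 1 = 0.
Proof. by apply: (addIr (lvf L 1)); rewrite add0r -{3}[1]mulr1 lvfM mulr1 mul1r. Qed.

Lemma dr_vr a b : dr a (vr b) = (a == b)%:R.
Proof.
rewrite /dr /vr mderivX mnm1E (inj_eq enum_rank_inj) eq_sym.
case: eqVneq => [->|_]; rewrite ?scale0r // scale1r.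
by rewrite (_ : (_ - _)%MM = 0%MM) ?mpolyX0 //; apply/mnmP => i; rewrite mnmBE subnn mnm0E.
Qed.

Lemma lvf_vr L b : lvf L (vr b) = \sum_a L a b *: vr a.
Proof.
apply: eq_bigr => a _; rewrite (bigD1 b) //= dr_vr eqxx mulr1 big1 ?addr0 // => c cb.
by rewrite dr_vr (negbTE cb) mulr0 scaler0.
Qed.

Lemma lvf_prod L (I : finType) (f : I -> R) :
  lvf L (\prod_i f i) = \sum_i lvf L (f i) * \prod_(j | j != i) f j.
Proof.
elim: (index_enum I) (index_enum_uniq I) => [_|i s IHs /= /andP[inots us]].
  by rewrite !big_nil lvf1.
rewrite !big_cons lvfM IHs // eqxx /=; congr (_ * _ + _).
  rewrite [RHS]big_seq_cond [LHS]big_seq; apply: eq_bigl => j.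
  by case: eqVneq => [->|_]; rewrite ?andbT ?(negbTE inots).
rewrite mulr_sumr big_seq [RHS]big_seq; apply: eq_bigr => j js.
rewrite big_cons; case: eqVneq => [ij|_]; first by rewrite ij js in inots.
by rewrite mulrCA.
Qed.

(** A derivative lowers the degree and the variable restores it. Hence the iterates of the Casimir
    operator on one polynomial stay in a finite-dimensional space. *)
Lemma msize_lvf L p k : (msize p <= k)%N -> (msize (lvf L p) <= k)%N.
Proof.
move=> pk; have sumk (f : A -> R) : (forall a, msize (f a) <= k)%N -> (msize (\sum_a f a) <= k)%N.
  move=> fk; apply: (big_ind (fun p => msize p <= k)%N) => [|q r qk rk|a _ //].
    by rewrite msize0.
  by apply: leq_trans (msizeD_le _ _) _; rewrite geq_max qk.
apply: (sumk) => a; apply: (sumk) => b.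
have [->|d0] := eqVneq (dr b p) 0; first by rewrite mulr0 scaler0 msize0.
apply: leq_trans (msizeZ_le _ _) _; rewrite msizeM // /vr; last first.
  by rewrite -msize_poly_eq0 msizeX.
rewrite msizeX mdeg1 add2n /=; apply/leq_trans: pk.
rewrite -(mlead_deg d0); have := mlead_supp d0.
rewrite mcoeff_msupp mcoeff_deriv mulrn_eq0 /= -mcoeff_msupp => /msize_mdeg_lt.
by rewrite mdegD mdeg1 addn1.
Qed.

End LinearVectorFields.

(** * The Fischer inner product on polynomials *)

Section Fischer.
Variable n : nat.
Notation C := algC.
Notation R := {mpoly C[n]}.
Implicit Types (p q r : R).

Definition mfact (m : 'X_{1..n}) : nat := (\prod_i (m i)`!)%N.

Lemma mfactDU m i : mfact (m + U_(i))%MM = ((m i).+1 * mfact m)%N.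
Proof.
rewrite /mfact (bigD1 i) //= [in RHS](bigD1 i) //= mnmDE mnm1E eqxx addn1 factS mulnA.
by congr (_ * _)%N; apply: eq_bigr => j ji; rewrite mnmDE mnm1E eq_sym (negbTE ji) addn0.
Qed.

(** The weights [mfact m] are those for which multiplication by a variable is adjoint to the
    derivative in it. *)
Definition fischer p q : C := \sum_(m <- msupp p) (mfact m)%:R * (p@_m * (q@_m)^*).

Lemma fischer_widen (s : seq 'X_{1..n}) p q :
  uniq s -> {subset msupp p <= s} ->
  fischer p q = \sum_(m <- s) (mfact m)%:R * (p@_m * (q@_m)^*).
Proof.
move=> us ps; rewrite [RHS](bigID (fun m => m \in msupp p)) /= [X in _ = _ + X]big1 ?addr0.
  rewrite -[RHS]big_filter; apply: perm_big; apply: uniq_perm => [||m].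
  - exact: msupp_uniq.
  - exact: filter_uniq.
  - by rewrite mem_filter; case: (boolP (m \in msupp p)) => //= /ps->.
by move=> m mp; rewrite memN_msupp_eq0 // mul0r mulr0.
Qed.

Lemma fischer_linear_l q : linear_for *%R (fischer^~ q).
Proof.
move=> c p1 p2 /=; pose s := undup (msupp (c *: p1 + p2) ++ msupp p1 ++ msupp p2).
have us : uniq s by apply: undup_uniq.
have sub x : {subset msupp x <= msupp (c *: p1 + p2) ++ msupp p1 ++ msupp p2} ->
    {subset msupp x <= s} by move=> xs m /xs; rewrite mem_undup.
rewrite !(@fischer_widen s) //; try by apply: sub => m; rewrite !mem_cat => ->; rewrite ?orbT.
rewrite mulr_sumr -big_split; apply: eq_bigr => m _ /=.
by rewrite mcoeffD mcoeffZ; ring.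
Qed.

Definition fischerl q p := fischer p q.
HB.instance Definition _ q :=
  GRing.isLinear.Build C R C *%R (fischerl q) (fischer_linear_l q).

Lemma fischerC p q : fischer p q = (fischer q p)^*.
Proof.
pose s := undup (msupp p ++ msupp q).
have us : uniq s by apply: undup_uniq.
rewrite !(@fischer_widen s) //; try by move=> m; rewrite mem_undup mem_cat => ->; rewrite ?orbT.
rewrite rmorph_sum; apply: eq_bigr => m _.
by rewrite !rmorphM /= conjCK rmorph_nat; congr (_ * _); apply: mulrC.
Qed.

Lemma fischerX m q : fischer 'X_[m] q = (mfact m)%:R * (q@_m)^*.
Proof. by rewrite /fischer msuppX big_seq1 mcoeffX eqxx mul1r. Qed.

Lemma fischer_eq0 p : fischer p p = 0 -> p = 0.
Proof.
move=> /eqP; rewrite /fischer big_seq psumr_eq0 => [|m _]; last first.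
  by rewrite mulr_ge0 ?ler0n // mul_conjC_ge0.
move=> /allP p0; apply/eqP; rewrite -msupp_eq0; case E: (msupp p) => [//|m s].
have := p0 m; rewrite E mem_head => /(_ isT) /=.
rewrite mulf_eq0 mul_conjC_eq0 pnatr_eq0 mcoeff_eq0 E mem_head orbF.
by rewrite gtn_eqF // prodn_gt0 // => i; rewrite fact_gt0.
Qed.

Lemma fischer_ge0 p : 0 <= fischer p p.
Proof. by apply: sumr_ge0 => m _; rewrite mulr_ge0 ?ler0n // mul_conjC_ge0. Qed.

(** Raising the exponent of [i] multiplies the squared norm of a monomial by [(m i).+1], the factor
    that the derivative produces. *)
Lemma fischer_mulX i p q : fischer ('X_i * p) q = fischer p q^`M(i).
Proof.
rewrite [p]mpolyE mulr_sumr -!/(fischerl _ _) !linear_sum /=; apply: eq_bigr => m _.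
rewrite -scalerAr !linearZ /= /fischerl -mpolyXD !fischerX; congr (_ * _).
rewrite [(U_(i) + m)%MM]addmC mcoeff_deriv rmorphMn /= mfactDU natrM -mulrA mulr_natl.
by rewrite mulrnAr.
Qed.

End Fischer.

Section FischerAdjoint.
Variable A : finType.
Notation C := algC.
Notation R := {mpoly C[#|A|]}.
Implicit Types (p q r : R) (L : A -> A -> C).

Lemma fischer_sumr (I : finType) p (f : I -> R) :
  fischer p (\sum_i f i) = \sum_i fischer p (f i).
Proof.
rewrite fischerC -/(fischerl p _) linear_sum rmorph_sum.
by apply: eq_bigr => i _; rewrite [RHS]fischerC.
Qed.

Lemma fischerZr p c q : fischer p (c *: q) = c^* * fischer p q.
Proof. by rewrite fischerC -/(fischerl p _) linearZ rmorphM /= [in RHS]fischerC. Qed.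

Lemma fischer_lvf L L' p q : (forall a b, L' a b = (L b a)^*) ->
  fischer (lvf L p) q = fischer p (lvf L' q).
Proof.
move=> LL'; rewrite [lvf L' q]exchange_big /= fischer_sumr -/(fischerl q _) linear_sum.
apply: eq_bigr => a _ /=; rewrite fischer_sumr linear_sum; apply: eq_bigr => b _ /=.
rewrite linearZ /= fischerZr LL' conjCK /fischerl /vr /dr fischer_mulX; congr (_ * _).
by rewrite [RHS]fischerC fischer_mulX -fischerC.
Qed.

End FischerAdjoint.

(** * Casimir operators of families of vector fields closed under adjoints *)

Section Casimir.
Variables (A J : finType) (st : J -> J) (L : J -> A -> A -> algC).
Notation R := {mpoly algC[#|A|]}.
Implicit Types (p q m : R) (c e : J -> algC).
Hypothesis L_st : forall s a b, L (st s) a b = (L s b a)^*.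

(** Reality and symmetry under [st] make [lvfB c (st s)] the adjoint of [lvfB c s]. *)
Definition weight_ok c := forall s, c (st s) = c s /\ (c s)^* = c s.

Definition lvfB c s p : R := lvf (L s) p - c s *: p.

Definition eigen c p := forall s, lvf (L s) p = c s *: p.

(** For an admissible weight this is the sum over [s] of the adjoint of [lvfB c s] composed with
    [lvfB c s]: a positive self-adjoint operator whose kernel is the common kernel of the
    [lvfB c s]. *)
Definition casimir c p : R := \sum_s lvfB c (st s) (lvfB c s p).

Lemma eigenP c p : eigen c p <-> forall s, lvfB c s p = 0.
Proof.
by split=> ep s; [rewrite /lvfB ep subrr | apply/eqP; rewrite -subr_eq0; apply/eqP/ep].
Qed.

Lemma lvfB_is_linear c s : linear (lvfB c s).
Proof.
move=> a p q; rewrite /lvfB linearP scalerBr scalerDr !scalerA [c s * a]mulrC.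
by rewrite opprD addrACA.
Qed.
HB.instance Definition _ c s :=
  GRing.isLinear.Build algC R R *:%R (lvfB c s) (lvfB_is_linear c s).

Lemma casimir_is_linear c : linear (casimir c).
Proof.
move=> a p q; rewrite /casimir scaler_sumr -big_split.
by apply: eq_bigr => s _; rewrite /= !linearP.
Qed.
HB.instance Definition _ c :=
  GRing.isLinear.Build algC R R *:%R (casimir c) (casimir_is_linear c).

Lemma fischer_lvfB c s p q : weight_ok c ->
  fischer (lvfB c (st s) p) q = fischer p (lvfB c s q).
Proof.
move=> cok; have [cst creal] := cok s.
rewrite /lvfB -/(fischerl q _) linearB linearZ /= /fischerl [RHS]fischerC.
rewrite -/(fischerl p _) linearB linearZ /= /fischerl rmorphB rmorphM /= -!fischerC.
by rewrite cst creal (@fischer_lvf _ _ (L s)) // => a b; rewrite L_st conjCK.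
Qed.

Lemma casimir_eigen c p : weight_ok c -> casimir c p = 0 -> eigen c p.
Proof.
move=> cok cas0; apply/eigenP => s.
have : fischer (casimir c p) p = 0.
  by rewrite cas0 -/(fischerl p _) linear0.
rewrite -/(fischerl p _) linear_sum /= => /eqP; rewrite psumr_eq0 => [|s' _].
  move=> /allP/(_ s (mem_index_enum _)) /= /eqP; rewrite /fischerl fischer_lvfB //.
  exact: fischer_eq0.
by rewrite /fischerl fischer_lvfB // fischer_ge0.
Qed.

Lemma eigen_casimir c p : eigen c p -> casimir c p = 0.
Proof. by move=> /eigenP ep; apply: big1 => s _; rewrite ep linear0. Qed.

Lemma fischer_casimir c p q : weight_ok c ->
  fischer (casimir c p) q = fischer p (casimir c q).
Proof.
move=> cok; rewrite -/(fischerl q _) linear_sum fischer_sumr; apply: eq_bigr => s _.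
rewrite [LHS]fischer_lvfB //.
by rewrite [RHS]fischerC fischer_lvfB // -fischerC.
Qed.

(** By self-adjointness, the squared norm of C p is the product of C (C p) with p. *)
Lemma casimir_ker_im c p : weight_ok c -> casimir c (casimir c p) = 0 -> casimir c p = 0.
Proof.
move=> cok cas0; apply: fischer_eq0; rewrite fischer_casimir // cas0.
by rewrite fischerC -/(fischerl _ _) linear0 rmorph0.
Qed.

Lemma lvfBM c e s p m : eigen e m -> lvfB c s (p * m) = lvfB (fun s => c s - e s) s p * m.
Proof.
move=> em; rewrite /lvfB lvfM em mulrBl -scalerAr -scalerAl -addrA -scalerBl.
by rewrite -scaleNr opprB.
Qed.

(** Multiplication by an eigenvector shifts the weight: it carries the operator of weight [c - e] on
    coefficients to the one of weight [c] on products. *)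
Lemma casimirM c e p m : eigen e m ->
  casimir c (p * m) = casimir (fun s => c s - e s) p * m.
Proof.
by move=> em; rewrite mulr_suml; apply: eq_bigr => s _; rewrite !(lvfBM _ _ _ em).
Qed.

Lemma spanned_msize k : exists (K : nat) (b : 'I_K -> R),
  forall p, (msize p <= k)%N -> spanned b p.
Proof.
exists #|{: 'X_{1..#|A| < k}}|, (fun i => 'X_[enum_val i : 'X_{1..#|A| < k}]) => p pk.
exists (fun i => p@_(enum_val i : 'X_{1..#|A| < k})).
by rewrite [LHS](mpolywE pk) (reindex_onto enum_val enum_rank) => [|m _];
  rewrite ?enum_rankK //; apply: eq_bigl => i; rewrite enum_valK eqxx.
Qed.

Lemma msize_casimir c p k : (msize p <= k)%N -> (msize (casimir c p) <= k)%N.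
Proof.
have lvfBk s q : (msize q <= k)%N -> (msize (lvfB c s q) <= k)%N.
  move=> qk; apply: leq_trans (msizeD_le _ _) _; rewrite geq_max msize_lvf //= msizeN.
  exact: leq_trans (msizeZ_le _ _) _.
move=> pk; apply: (big_ind (fun p => msize p <= k)%N) => [|q r qk rk|s _].
- by rewrite msize0.
- by apply: leq_trans (msizeD_le _ _) _; rewrite geq_max qk.
- by do 2!apply: (lvfBk).
Qed.

Lemma casimir_decomposition c p : weight_ok c -> exists q, eigen c (p - casimir c q).
Proof.
move=> cok; have [K [b bP]] := spanned_msize (msize p).
have [||q q0] := @ker_im_decomposition _ _ (casimir c) p K b.
- by move=> x; apply: casimir_ker_im.
- by move=> i; apply: bP; elim: i => //= i IHi; apply: msize_casimir.
by exists q; apply: casimir_eigen.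
Qed.

(* The Reynolds operator in disguise: subtracting its image under the Casimir operator
   from each coefficient leaves the combination unchanged, because the total
   correction lies both in the kernel and in the image of a self-adjoint operator. *)
Theorem eigen_coefficients (I : finType) (c : J -> algC) (e : I -> J -> algC)
    (a m : I -> R) p :
  weight_ok c -> (forall i, weight_ok (e i)) -> eigen c p -> (forall i, eigen (e i) (m i)) ->
  p = \sum_i a i * m i ->
  exists k : I -> R, (forall i, eigen (fun s => c s - e i s) (k i)) /\ p = \sum_i k i * m i.
Proof.
move=> cok eok cp em pE.
have ceok i : weight_ok (fun s => c s - e i s).
  by move=> s; have [-> c1] := cok s; have [-> e1] := eok i s; rewrite rmorphB /= c1 e1.
have /fin_all_exists[b bP] i := casimir_decomposition (a i) (ceok i).
exists (fun i => a i - casimir (fun s => c s - e i s) (b i)); split=> //.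
have diffE : p - \sum_i (a i - casimir (fun s => c s - e i s) (b i)) * m i =
    casimir c (\sum_i b i * m i).
  rewrite [RHS]linear_sum {1}pE -sumrB; apply: eq_bigr => i _ /=.
  by rewrite (casimirM _ _ (em i)) mulrBl opprB addrC subrK.
apply/eqP; rewrite -subr_eq0 diffE; apply/eqP/casimir_ker_im => //.
rewrite -diffE linearB /= eigen_casimir // sub0r [X in - X](_ : _ = 0) ?oppr0 //.
rewrite [LHS]linear_sum big1 // => i _ /=.
by rewrite (casimirM _ _ (em i)) eigen_casimir ?mul0r.
Qed.

End Casimir.

(** * Highest weight vectors *)

Section Words.
Variables (I : finType) (T : finType).
Implicit Types (f : {ffun I -> T}).

Definition upd f x t : {ffun I -> T} := [ffun y => if y == x then t else f y].

Definition pact f (s : {perm I}) : {ffun I -> T} := [ffun x => f (s x)].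

Lemma pactM f s t : pact (pact f s) t = pact f (t * s)%g.
Proof. by apply/ffunP => x; rewrite !ffunE permM. Qed.

Lemma pact1 f : pact f 1%g = f.
Proof. by apply/ffunP => x; rewrite ffunE perm1. Qed.

Lemma pactK s : cancel (pact^~ s) (pact^~ s^-1%g).
Proof. by move=> f; rewrite pactM mulVg pact1. Qed.

Lemma pactKV s : cancel (pact^~ s^-1%g) (pact^~ s).
Proof. by move=> f; rewrite pactM mulgV pact1. Qed.

Lemma pact_inj s : injective (pact^~ s).
Proof. exact: can_inj (pactK s). Qed.

Lemma upd_id f x : upd f x (f x) = f.
Proof. by apply/ffunP => y; rewrite ffunE; case: eqP => // ->. Qed.

Lemma upd_upd f x t u : upd (upd f x t) x u = upd f x u.
Proof. by apply/ffunP => y; rewrite !ffunE; case: eqP. Qed.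

Lemma upd_same f x t : upd f x t x = t.
Proof. by rewrite ffunE eqxx. Qed.

Lemma upd_pact f s x t : upd (pact f s) x t = pact (upd f (s x) t) s.
Proof. by apply/ffunP => y; rewrite !ffunE (inj_eq perm_inj). Qed.

End Words.

Definition content (I T : finType) (f : {ffun I -> T}) (t : T) : nat := #|[pred x | f x == t]|.

Lemma content_pact (I T : finType) (f : {ffun I -> T}) s t :
  content (pact f s) t = content f t.
Proof.
rewrite -[RHS](card_image (@perm_inj _ s^-1%g)); apply: eq_card => x; rewrite inE ffunE.
apply/idP/imageP => [fs|[y]]; first by exists (s x); rewrite ?permK.
by rewrite inE => fy ->; rewrite permKV.
Qed.

Lemma content_eqP n (T : finType) (f g : {ffun 'I_n -> T}) :
  content f =1 content g -> exists s, g = pact f s.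
Proof.
move=> fg; have cnt (h : {ffun 'I_n -> T}) t : count_mem t [tuple h x | x < n] = content h t.
  rewrite /content -sum1_card -sum1_count big_map /= big_enum_cond /=.
  by apply: eq_bigl => x; rewrite inE.
have /tuple_permP[s gs] : perm_eq [tuple g x | x < n] [tuple f x | x < n].
  by apply/allP => t _ /=; rewrite !cnt fg.
exists s; apply/ffunP => x.
have := congr1 (fun l => nth (g x) l x) gs.
by rewrite !ffunE -!tnth_nth !tnth_mktuple.
Qed.

Section HighestWeight.
Variables (R n : nat) (la : nat -> nat).
Notation C := algC.
Notation word := {ffun 'I_n -> 'I_R}.
Implicit Types (f g : word) (v w e : word -> C).

(* [v] is a vector of the n-th tensor power of the natural module of gl_R, whose standard basis
   consists of the words; the second clause says that the E_ij with i < j annihilate it. *)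
Definition hwv v : Prop :=
  (forall f, v f != 0 -> forall i, content f i = la i) /\
  forall i j : 'I_R, (i < j)%N -> forall f, \sum_(x | f x == i) v (upd f x j) = 0.

Lemma eq_hwv v w : v =1 w -> hwv v -> hwv w.
Proof.
move=> vw [v1 v2]; split=> [f|i j ij f]; first by rewrite -vw; apply: v1.
by rewrite -[RHS](v2 i j ij f); apply: eq_bigr => x _; rewrite vw.
Qed.

Lemma hwv_sum (J : finType) (c : J -> C) (v : J -> word -> C) :
  (forall k, hwv (v k)) -> hwv (fun f => \sum_k c k * v k f).
Proof.
move=> hv; split=> [f|i j ij f].
  case: (pickP (fun k => v k f != 0)) => [k /(proj1 (hv k) f) //|v0] /negP[].
  by apply/eqP/big1 => k _; move: (v0 k) => /negbFE/eqP->; rewrite mulr0.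
rewrite exchange_big big1 //= => k _; rewrite -mulr_sumr.
by rewrite (proj2 (hv k)) ?mulr0.
Qed.

Lemma hwv_pact v s : hwv v -> hwv (fun f => v (pact f s)).
Proof.
case=> v1 v2; split=> [f /v1 cf i|i j ij f]; first by rewrite -cf content_pact.
rewrite -[RHS](v2 i j ij (pact f s)) [RHS](reindex_inj (@perm_inj _ s^-1%g)) /=.
by apply: eq_big => [x|x _]; rewrite ?ffunE ?upd_pact permKV.
Qed.

Lemma hwv_lin2 a b v w : hwv v -> hwv w -> hwv (fun f => a * v f + b * w f).
Proof.
move=> hv hw; apply: (@eq_hwv (fun f => \sum_(k : bool) (if k then a else b) *
  (if k then v else w) f)) => [f|]; first by rewrite big_bool.
by apply: hwv_sum => -[].
Qed.

(** The two words are rearrangements of each other, so their letters have equal sums; if no letter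
    of [g] exceeded that of [f], all would agree. *)
Lemma exists_lt_word (f g : word) : content f =1 content g -> g != f ->
  exists x, (f x < g x)%N.
Proof.
move=> fg gf; apply/existsP; apply: contraNT gf; rewrite negb_exists => /forallP gef.
have [s gs] := content_eqP fg.
have sumfg : (\sum_x g x = \sum_x f x)%N.
  rewrite [RHS](reindex_inj (@perm_inj _ s)) gs; apply: eq_bigr => x _.
  by rewrite ffunE.
have lefg x : (g x <= f x ?= iff (g x == f x))%N.
  by split; [rewrite leqNgt | rewrite -val_eqE].
have [_] : (\sum_x g x <= \sum_x f x ?= iff [forall x, g x == f x])%N.
  exact: leqif_sum.
by rewrite sumfg eqxx => /esym/forallP gxfx; apply/eqP/ffunP => x; apply/eqP.
Qed.

(* The invariants of the stabilizer of [f0] among highest weight vectors are at most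
   one-dimensional: moving entries of [g] to their row in [f0] rewrites [w g] in terms of
   values at words closer to [f0]. *)
Lemma hwv_stab_eq0 f0 w : (forall i, content f0 i = la i) -> hwv w ->
  (forall s, pact f0 s = f0 -> forall g, w (pact g s) = w g) ->
  w f0 = 0 -> forall g, w g = 0.
Proof.
move=> cf0 [w1 w2] wY wf0 g.
have [k] := ubnP #|[pred x | g x != f0 x]|; elim: k g => // k IHk g; rewrite ltnS => gk.
apply/eqP/idPn => wg.
have [gf0|gf0] := eqVneq g f0; first by rewrite gf0 wf0 eqxx in wg.
have [|x0 ltx0] := @exists_lt_word f0 g _ gf0; first by move=> i; rewrite cf0 (w1 g wg).
set i := f0 x0 in ltx0; set j := g x0 in ltx0; pose g' := upd g x0 i.
(* In the relation for E_ij at [g'], the term at [x0] is [w g]. A term at [x] with [f0 x != i]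
   vanishes by induction: [x0] now agrees with [f0], and [x] already disagreed. *)
have := w2 i j ltx0 g'; rewrite (bigID (fun x => f0 x == i)) /=.
rewrite [X in _ + X]big1 => [|x /andP[gx fx]]; last first.
  have xx0 : x != x0 by apply: contraNneq fx => ->.
  apply: IHk; apply: leq_trans gk; rewrite [X in (_ < X)%N](cardD1 x0) inE.
  rewrite neq_ltn ltx0 orbT add1n ltnS; apply: subset_leq_card; apply/subsetP => y.
  rewrite !inE !ffunE; case: (eqVneq y x) => [->|yx].
    rewrite xx0 /= => _; apply: contraNneq fx => <-.
    by move: gx; rewrite ffunE (negbTE xx0).
  by case: (eqVneq y x0) => [->|//]; rewrite eqxx.
rewrite addr0 (eq_bigr (fun=> w g)) => [|x /andP[gx fx]].
  rewrite sumr_const => /eqP; rewrite mulrn_eq0 (negbTE wg) orbF => /eqP/card0_eq/(_ x0).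
  by rewrite /in_mem /= ffunE !eqxx.
have [->|xx0] := eqVneq x x0; first by rewrite upd_upd upd_id.
(* Here [f0 x = f0 x0 = i], so the transposition fixes [f0], and it turns [g] into the word of this
   term. All remaining terms thus equal [w g]. *)
rewrite -(wY (tperm x x0)); last first.
  apply/ffunP => y; rewrite ffunE; case: tpermP => // ->; rewrite ?(eqP fx) //.
congr w; apply/ffunP => y; rewrite !ffunE.
move: gx; rewrite ffunE (negbTE xx0) => /eqP gx.
case: tpermP => [->|->|/eqP nyx /eqP nyx0]; rewrite ?eqxx //.
  by rewrite eq_sym (negbTE xx0).
by rewrite (negbTE nyx) (negbTE nyx0).
Qed.

(** The inner product of [w] with a translate of [e]; [orbit_kernel] is then the frame operator of
    the orbit of [e], which is equivariant and has its image in the span of the orbit. *)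
Definition orbit_coef e w (s : 'S_n) : C := \sum_g w g * (e (pact g s))^*.

Definition orbit_kernel e w f : C := \sum_(s : 'S_n) orbit_coef e w s * e (pact f s).

Lemma orbit_kernel_hwv e w : hwv e -> hwv (orbit_kernel e w).
Proof. by move=> he; apply: hwv_sum => s; apply: hwv_pact. Qed.

Lemma eq_orbit_kernel e v w : v =1 w -> orbit_kernel e v =1 orbit_kernel e w.
Proof.
move=> vw f; apply: eq_bigr => s _; congr (_ * _).
by apply: eq_bigr => g _; rewrite vw.
Qed.

Lemma orbit_kernel_pact e w t f :
  orbit_kernel e (fun g => w (pact g t)) f = orbit_kernel e w (pact f t).
Proof.
rewrite /orbit_kernel (reindex_inj (mulIg t)) /=; apply: eq_bigr => s _.
rewrite pactM; congr (_ * _).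
rewrite /orbit_coef (reindex_inj (@pact_inj _ _ t^-1%g)) /=; apply: eq_bigr => g _.
by rewrite pactKV pactM mulgK.
Qed.

Lemma orbit_kernel_sum e (J : finType) (P : pred J) (c : J -> C) (v : J -> word -> C) f :
  orbit_kernel e (fun g => \sum_(k | P k) c k * v k g) f =
  \sum_(k | P k) c k * orbit_kernel e (v k) f.
Proof.
under [RHS]eq_bigr => k _ do rewrite mulr_sumr.
rewrite exchange_big; apply: eq_bigr => s _ /=.
under [RHS]eq_bigr => k _ do rewrite mulrA.
rewrite -mulr_suml; congr (_ * _).
under [RHS]eq_bigr => k _ do rewrite mulr_sumr.
rewrite exchange_big; apply: eq_bigr => g _ /=.
by rewrite mulr_suml; apply: eq_bigr => k _; rewrite mulrA.
Qed.

(* A form of Schur's lemma: an equivariant operator acts on the highest weight vectors as a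
   scalar, because it is determined by its effect at one word after averaging over the
   stabilizer of that word. *)
Theorem hwv_reproducing e f0 : hwv e -> e f0 != 0 ->
  exists2 c, c != 0 & forall w, hwv w -> forall f, orbit_kernel e w f = c * w f.
Proof.
move=> he ef0; have cf0 : forall i, content f0 i = la i by apply: (proj1 he).
pose Y := [pred s : 'S_n | pact f0 s == f0].
pose avg w f := \sum_(s | Y s) w (pact f s).
have Y0 : #|Y|%:R != 0 :> C.
  by rewrite pnatr_eq0 -lt0n; apply/card_gt0P; exists 1%g; rewrite inE pact1.
have avg_f0 w : avg w f0 = #|Y|%:R * w f0.
  rewrite /avg (eq_bigr (fun=> w f0)) => [|s /eqP-> //].
  by rewrite sumr_const mulr_natl.
have avg_inv w t : pact f0 t = f0 -> forall g, avg w (pact g t) = avg w g.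
  move=> tY g; rewrite /avg [RHS](reindex_inj (mulIg t)) /=.
  by apply: eq_big => [s|s _]; rewrite -pactM // tY.
have avg_hwv w : hwv w -> hwv (avg w).
  move=> hw; apply: (@eq_hwv (fun f => \sum_s (Y s)%:R * w (pact f s))) => [f|].
    rewrite /avg [RHS]big_mkcond /=; apply: eq_bigr => s _.
    by case: (_ == f0); rewrite ?mul1r ?mul0r.
  by apply: hwv_sum => s; apply: hwv_pact.
(* The difference of the two sides is a stabilizer-invariant highest weight vector that vanishes at
   [f0]. *)
have avgE w : hwv w -> forall f, avg w f = w f0 / e f0 * avg e f.
  move=> hw f; apply/eqP; rewrite -subr_eq0 -mulNr -[X in X + _]mul1r; apply/eqP.
  apply: (@hwv_stab_eq0 f0 (fun f => 1 * avg w f + - (w f0 / e f0) * avg e f)) => //.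
  - by apply: hwv_lin2; apply: avg_hwv.
  - by move=> t tY g; rewrite !avg_inv.
  - by rewrite !avg_f0 mul1r mulNr mulrCA divfK ?subrr.
have avg_kernel w f : avg (orbit_kernel e w) f = orbit_kernel e (avg w) f.
  transitivity (orbit_kernel e (fun g => \sum_(s | Y s) 1 * w (pact g s)) f).
    by rewrite orbit_kernel_sum; apply: eq_bigr => s _; rewrite mul1r orbit_kernel_pact.
  by apply: eq_orbit_kernel => g; apply: eq_bigr => s _; rewrite mul1r.
pose c := orbit_kernel e e f0 / e f0.
have kernel_f0 w : hwv w -> orbit_kernel e w f0 = c * w f0.
  move=> hw; apply: (mulfI Y0); rewrite -avg_f0 avg_kernel.
  transitivity (orbit_kernel e (fun g => \sum_(k : 'I_1) (w f0 / e f0) * avg e g) f0).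
    by apply: eq_orbit_kernel => g; rewrite big_ord1 avgE.
  by rewrite orbit_kernel_sum big_ord1 -avg_kernel avg_f0 /c; ring.
have kernelE w : hwv w -> forall f, orbit_kernel e w f = c * w f.
  move=> hw f; have [cf|ncf] := classic (forall i, content f i = la i).
    have [s ->] : exists s, f = pact f0 s by apply: content_eqP => i; rewrite cf cf0.
    by rewrite -orbit_kernel_pact kernel_f0 //; apply: hwv_pact.
  have zero v : hwv v -> v f = 0.
    by case=> v1 _; apply/eqP; apply/idPn => /v1.
  by rewrite !zero ?mulr0 //; apply: orbit_kernel_hwv.
(* If [c = 0], pairing [orbit_kernel e e] with [e] gives zero; but that pairing is the sum of the
   squared moduli of the [orbit_coef e e s], and the one at the identity is the squared norm of
   [e]. *)
exists c => //; apply/eqP => c0.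
have : \sum_f orbit_kernel e e f * (e f)^* = 0.
  by apply: big1 => f _; rewrite kernelE // c0 !mul0r.
under eq_bigr => f _ do rewrite mulr_suml.
rewrite exchange_big /= => /eqP.
rewrite (eq_bigr (fun s => orbit_coef e e s * (orbit_coef e e s)^*)) => [|s _]; last first.
  under eq_bigr => f _ do rewrite -mulrA.
  rewrite -mulr_sumr rmorph_sum; congr (_ * _); apply: eq_bigr => f _.
  by rewrite rmorphM /= conjCK mulrC.
rewrite psumr_eq0 => [/allP/(_ 1%g (mem_index_enum _))/=|s _]; last exact: mul_conjC_ge0.
rewrite mul_conjC_eq0 /orbit_coef => /eqP/eqP.
rewrite psumr_eq0 => [/allP/(_ f0 (mem_index_enum _))/=|g _]; rewrite pact1.
  by rewrite mul_conjC_eq0 (negbTE ef0).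
exact: mul_conjC_ge0.
Qed.

End HighestWeight.

(** * Specht modules *)

Definition cell_index (l : seq nat) (rc : nat * nat) : nat := (sumn (take rc.1 l) + rc.2)%N.

Lemma cell_index_lt l r c : (c < nth 0 l r)%N -> (cell_index l (r, c) < sumn l)%N.
Proof.
rewrite /cell_index /=; elim: l r => [|a l IHl] [|r] //= ltc; first by lia.
by have := IHl r ltc; lia.
Qed.

Lemma cell_indexK l r c : (c < nth 0 l r)%N -> cell_of l (cell_index l (r, c)) = (r, c).
Proof.
rewrite /cell_index; elim: l r => [|a l IHl] [|r] //= ltc; first by rewrite add0n ltc.
rewrite ifF; last by lia.
by rewrite (_ : a + _ + c - a = sumn (take r l) + c)%N ?IHl //; lia.
Qed.

Lemma cell_ofP l j : (j < sumn l)%N -> ((cell_of l j).2 < nth 0 l (cell_of l j).1)%N.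
Proof.
elim: l j => [|a l IHl] j //= ltj; case: (ltnP j a) => //= leaj.
by apply: IHl; lia.
Qed.

Lemma cell_ofK l j : (j < sumn l)%N -> cell_index l (cell_of l j) = j.
Proof.
rewrite /cell_index; elim: l j => [|a l IHl] j //= ltj; case: (ltnP j a) => //= leaj.
by have := IHl (j - a)%N; lia.
Qed.

Lemma nth_sorted_geq l i j : sorted geq l -> (i <= j)%N -> (nth 0 l j <= nth 0 l i)%N.
Proof.
move=> sl leij; have [lt|ge] := ltnP j (size l); last by rewrite nth_default.
apply: (sorted_leq_nth _ _ 0%N sl) => //; rewrite ?inE.
- by move=> y x z /= xy yz; apply: leq_trans yz xy.
- by move=> x /=.
- exact: leq_ltn_trans leij lt.
Qed.

Lemma size_leq_sumn l : all (fun x => 0 < x)%N l -> (size l <= sumn l)%N.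
Proof. by elim: l => //= a l IHl /andP[a0 /IHl]; lia. Qed.

Section Specht.
Variables (n : nat) (la : seq nat).
Hypotheses (la_part : is_partition la) (la_sum : sumn la = n).
Notation C := algC.
Notation word := (tabloid n).

Let la_sorted : sorted geq la. Proof. by case/andP: la_part. Qed.
Let la_size : (size la <= n)%N.
Proof. by rewrite -la_sum size_leq_sumn //; case/andP: la_part. Qed.

Definition crow (x : 'I_n) : nat := (cell_of la x).1.
Definition ccol (x : 'I_n) : nat := (cell_of la x).2.

Lemma crowcol_inj x y : crow x = crow y -> ccol x = ccol y -> x = y.
Proof.
move=> rxy cxy; apply: val_inj; rewrite /= -[LHS](@cell_ofK la) ?la_sum //.
rewrite -[RHS](@cell_ofK la) ?la_sum //; congr cell_index.
by rewrite [LHS]surjective_pairing [RHS]surjective_pairing; congr (_, _).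
Qed.

Lemma crowcol_surj r c : (c < nth 0 la r)%N -> exists x, crow x = r /\ ccol x = c.
Proof.
move=> ltc; have lti := cell_index_lt ltc; rewrite la_sum in lti.
by exists (Ordinal lti); rewrite /crow /ccol /= cell_indexK.
Qed.

Lemma crow_size x : (crow x < size la)%N.
Proof.
rewrite ltnNge; apply/negP => /(nth_default 0%N) ge.
by have := @cell_ofP la x; rewrite la_sum ltn_ord -/(crow x) ge => /(_ isT).
Qed.

Definition row_word : word := [ffun x => inord (crow x)].

Lemma row_wordE x : row_word x = crow x :> nat.
Proof.
by rewrite ffunE inordK // ltnS (leq_trans _ la_size) // ltnW // crow_size.
Qed.

Lemma content_row_word i : content row_word i = nth 0%N la i.
Proof.
pose h (c : 'I_(nth 0 la i)) : 'I_n := Ordinal (eq_rect _ (fun m => _ < m)%N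
  (cell_index_lt (ltn_ord c)) _ la_sum).
have hE c : crow (h c) = i /\ ccol (h c) = c.
  by rewrite /crow /ccol /h /= cell_indexK.
have h_inj : injective h.
  by move=> c d cd; apply: val_inj; rewrite /= -(proj2 (hE c)) cd (proj2 (hE d)).
rewrite -[RHS]card_ord -(card_image h_inj); apply: eq_card => x; rewrite inE.
apply/idP/imageP => [/eqP/(congr1 val) /=|[c _ ->]]; last first.
  by apply/eqP/val_inj; rewrite /= row_wordE (proj1 (hE c)).
rewrite row_wordE => rx; have := @cell_ofP la x.
rewrite la_sum ltn_ord -/(crow x) rx => /(_ isT) ltc.
exists (Ordinal ltc) => //; apply: crowcol_inj; first by rewrite rx (proj1 (hE _)).
by rewrite (proj2 (hE _)).
Qed.

Definition col_stab (p : 'S_n) : bool := [forall x, ccol (p x) == ccol x].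

Lemma col_stabP (p : 'S_n) : reflect (forall x, ccol (p x) = ccol x) (col_stab p).
Proof. by apply: (iffP forallP) => H x; apply/eqP/H. Qed.

(** The coordinates of the polytabloid of the tableau filled in reading order; [polytabE] shows that
    the other polytabloids are its translates. *)
Definition young_vec (f : word) : C :=
  \sum_(p : 'S_n | col_stab p) (-1) ^+ p * (pact row_word p^-1 == f)%:R.

Lemma young_vec_neq0 f : young_vec f != 0 -> exists2 p, col_stab p & f = pact row_word p^-1.
Proof.
case: (pickP (fun p : 'S_n => col_stab p && (pact row_word p^-1 == f))).
  move=> p /andP[pC /eqP <-].
  by exists p.
move=> none; rewrite /young_vec big1 ?eqxx // => p pC; have := none p; rewrite pC /= => ->.
by rewrite mulr0.
Qed.

(** A column-preserving permutation that also preserves rows is the identity, so a single term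
    survives. *)
Lemma young_vec_row : young_vec row_word = 1.
Proof.
rewrite /young_vec (bigD1 1%g) /=; last by apply/col_stabP => x; rewrite perm1.
rewrite odd_perm1 invg1 pact1 eqxx mul1r big1 ?addr0 // => p /andP[/col_stabP pC p1].
case: eqP => [rp|]; last by rewrite mulr0.
case/eqP: p1; apply/permP => x; rewrite perm1; apply: crowcol_inj => //.
by rewrite -!row_wordE -{1}rp ffunE permK.
Qed.

Lemma young_vec_anti f q : col_stab q -> young_vec (pact f q) = (-1) ^+ q * young_vec f.
Proof.
move=> /col_stabP qC; rewrite /young_vec mulr_sumr (reindex_inj (mulIg q^-1%g)) /=.
have qVC y : ccol (q^-1%g y) = ccol y by rewrite -[in RHS](permKV q y) qC.
apply: eq_big => [p|p _]; first by apply: eq_forallb => x; rewrite permM qVC.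
rewrite invMg invgK -pactM (inj_eq (@pact_inj _ _ q)) odd_permM odd_permV.
by rewrite signr_addb [_ ^+ p * _]mulrC mulrA.
Qed.

(** If a term of the E_ij sum is nonzero, its modified entry [x] sits in row [j] of some
    column-permuted filling; as i < j, the same column has an entry [y] in row [i]. Exchanging [x]
    and [y] fixes [f] but changes the sign of [young_vec], so the sum equals its opposite. *)
Lemma young_vec_hwv : hwv (nth 0%N la) young_vec.
Proof.
split=> [f /young_vec_neq0[p _ ->] i|i j ij f].
  by rewrite content_pact content_row_word.
pose u (f : word) := \sum_(x | f x == i) young_vec (upd f x j); rewrite -/(u f).
apply/eqP/idPn => uf.
have [x /eqP fx ex] : exists2 x, f x == i & young_vec (upd f x j) != 0.
  apply/exists_inP; apply: contraR uf; rewrite negb_exists_in => /forall_inP u0.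
  by apply/eqP/big1 => x /u0; rewrite negbK => /eqP.
have [p /col_stabP pC fp] := young_vec_neq0 ex.
have updE y : crow (p^-1%g y) = upd f x j y :> nat.
  by rewrite fp ffunE row_wordE.
have rx : crow (p^-1%g x) = j by rewrite updE upd_same.
have [y0 [ry0 cy0]] : exists y0, crow y0 = i /\ ccol y0 = ccol (p^-1%g x).
  apply: crowcol_surj; apply: leq_trans (nth_sorted_geq la_sorted (ltnW ij)).
  by have := @cell_ofP la (p^-1%g x); rewrite la_sum ltn_ord -/(crow _) rx => /(_ isT).
have pCV z : ccol (p^-1%g z) = ccol z by rewrite -[in RHS](permKV p z) pC.
pose y := p y0; have yx : y != x.
  apply: contraTneq ij => yx; rewrite -leqNgt -rx -ry0 -yx /y permK.
  by [].
have fy : f y = i.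
  apply: val_inj; rewrite /= -ry0 -[y0](permK p) -/y updE ffunE (negbTE yx).
  by [].
have qC : col_stab (tperm x y).
  have cxy : ccol x = ccol y by rewrite /y pC cy0 pCV.
  by apply/col_stabP => z; case: tpermP => [->|->|].
have fq : pact f (tperm x y) = f.
  by apply/ffunP => z; rewrite ffunE; case: tpermP => [->|->|//]; rewrite fx fy.
have : u f = - u f.
  rewrite -[in LHS]fq /u (reindex_inj (@perm_inj _ (tperm x y))) /= -sumrN.
  apply: eq_big => [z|z _]; first by rewrite ffunE tpermK.
  by rewrite upd_pact tpermK young_vec_anti // odd_tperm eq_sym yx mulN1r.
move/eqP; rewrite -addr_eq0 -mulr2n mulrn_eq0 /= => /eqP u0.
by rewrite u0 eqxx in uf.
Qed.

Lemma polytabE s f : polytab la s 0 (enum_rank f) = young_vec (pact f s).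
Proof.
rewrite /young_vec summxE (reindex_inj (conjg_inj s)) /=.
apply: eq_big => [p|p _].
  apply/forallP/col_stabP => pC x; last first.
    by rewrite conjgE !permM permK -!/(ccol _) pC.
  by have := eqP (pC (s x)); rewrite conjgE !permM !permK.
rewrite !mxE eqxx /= odd_permJ; congr (_ * _%:R); rewrite (inj_eq enum_rank_inj) eq_sym.
rewrite -(inj_eq (@pact_inj _ _ s)); congr (_ == _).
by apply/ffunP => x; rewrite !ffunE conjgE !invMg invgK !permM !permK.
Qed.

(** From right to left, the reproducing formula writes [u], up to the factor [c], as a combination
    of translates of [young_vec]. *)
Lemma young_vec_span (u : 'rV[C]_(NT n)) :
  (u <= specht_mx n la)%MS <-> hwv (nth 0%N la) (fun f => u 0 (enum_rank f)).
Proof.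
split=> [/submxP[w ->]|hu].
  apply: (@eq_hwv _ _ _ (fun f => \sum_i w 0 i * young_vec (pact f (enum_val i)))) => [f|].
    by rewrite !mxE; apply: eq_bigr => i _; rewrite mxE polytabE.
  by apply: hwv_sum => i; apply/hwv_pact/young_vec_hwv.
have [|c c0 cP] := hwv_reproducing young_vec_hwv (f0 := row_word).
  by rewrite young_vec_row oner_neq0.
have -> : u = \sum_s (c^-1 * orbit_coef young_vec (fun f => u 0 (enum_rank f)) s) *: polytab la s.
  apply/rowP => k; rewrite -[k]enum_valK summxE.
  apply: (mulfI c0); rewrite -(cP _ hu) mulr_sumr; apply: eq_bigr => s _.
  by rewrite mxE polytabE -mulrA mulVKf.
apply: summx_sub => s _; apply: scalemx_sub.
suff -> : polytab la s = row (enum_rank s) (specht_mx n la) by apply: row_sub.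
by apply/rowP => k; rewrite !mxE enum_rankK.
Qed.

End Specht.

(** * Kronecker coefficients as dimensions *)

Lemma has_dim_bij (F : fieldType) (E E' : lmodType F) (U : E -> Prop) (U' : E' -> Prop)
    (f : E -> E') r :
  (forall (a : F) x y, f (a *: x + y) = a *: f x + f y) ->
  subspace U -> (forall x, U x -> U' (f x)) ->
  (forall x, U x -> f x = 0 -> x = 0) -> (forall y, U' y -> exists2 x, U x & f x = y) ->
  has_dim U r -> has_dim U' r.
Proof.
move=> fL [U0 UL] fU finj fsurj [b [Ub indb spb]].
have f0 : f 0 = 0.
  have := fL 1 0 0; rewrite !scale1r addr0 => f00.
  by apply: (addIr (f 0)); rewrite -f00 add0r.
have fsum (c : 'I_r -> F) : f (\sum_i c i *: b i) = \sum_i c i *: f (b i).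
  by elim/big_rec2: _ => // i x y _ <-; rewrite fL.
have Usum (c : 'I_r -> F) : U (\sum_i c i *: b i).
  by elim/big_rec: _ => // i x _ Ux; apply: UL.
exists (fun i => f (b i)); split=> [i|c|y /fsurj[x /spb[c ->] <-]]; first exact/fU/Ub.
  by rewrite -fsum => /(finj _ (Usum c)) /indb.
by exists c; rewrite fsum.
Qed.

Lemma mxtrace_idempotent (F : fieldType) m (P : 'M[F]_m) : P *m P = P -> \tr P = (\rank P)%:R.
Proof.
move=> PP; have YX1 r (X : 'M[F]_(m, r)) (Y : 'M[F]_(r, m)) : row_full X -> row_free Y ->
    X *m Y *m (X *m Y) = X *m Y -> Y *m X = 1%:M.
  move=> /row_fullP[D DX] /row_freeP[D' YD'] /(congr1 (fun M => D *m M *m D')).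
  by rewrite !mulmxA DX !mul1mx -!mulmxA YD' !mulmx1.
rewrite -{1}[P]mulmx_base mxtrace_mulC YX1 ?mxtrace1 ?col_base_full ?row_base_free //.
by rewrite mulmx_base.
Qed.

Lemma has_dim_row_space (F : fieldType) m (P : 'M[F]_m) :
  has_dim (fun u : 'rV[F]_m => (u <= P)%MS) (\rank P).
Proof.
exists (fun i => row i (row_base P)); split=> [i|c c0 i|u].
- by apply: submx_trans (row_sub _ _) _; rewrite eq_row_base.
- have c0' : \row_i c i *m row_base P = 0.
    by rewrite mulmx_sum_row -[RHS]c0; apply: eq_bigr => j _; rewrite mxE.
  have /row_freeP[D PD] := row_base_free P.
  have := congr1 (mulmx^~ D) c0'; rewrite -mulmxA PD mulmx1 mul0mx => /rowP/(_ i).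
  by rewrite !mxE.
- rewrite -(eq_row_base P) => /submxP[w ->]; exists (w 0); exact: mulmx_sum_row.
Qed.

Section TensorReproduce.
Variables (C : comRingType) (I W : finType) (Pi : I -> W -> W -> C).
Implicit Types (v : {ffun I -> W} -> C) (h : {ffun I -> W}).

Lemma tensor_reproduce v :
  (forall s h, v h = \sum_g v (upd h s g) * Pi s g (h s)) ->
  forall h, v h = \sum_h' v h' * \prod_s Pi s (h' s) (h s).
Proof.
move=> vPi h.
(* Generalize to reproducing only in the slots of [l], the other slots of [h'] being frozen at those
   of [h]. *)
suff part (l : seq I) : uniq l -> v h =
    \sum_(h' : {ffun I -> W} | [forall s, (s \in l) || (h' s == h s)])
      v h' * \prod_(s <- l) Pi s (h' s) (h s).
  rewrite (part _ (enum_uniq I)); apply: eq_big => [h'|h' _].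
    by apply/forallP => s; rewrite mem_enum.
  by rewrite big_enum.
elim: l => [_|s0 l IHl /= /andP[s0l /IHl {IHl}->]].
  rewrite (big_pred1 h) => [|h']; first by rewrite big_nil mulr1.
  by apply/forallP/eqP => [h'h|-> s]; [apply/ffunP => s; apply/eqP/h'h | rewrite eqxx].
transitivity (\sum_(h' : {ffun I -> W} | [forall s, (s \in l) || (h' s == h s)])
    \sum_g v (upd h' s0 g) * (Pi s0 g (h s0) * \prod_(s <- l) Pi s (h' s) (h s))).
  apply: eq_bigr => h' /forallP/(_ s0); rewrite (negbTE s0l) /= => /eqP <-.
  rewrite (vPi s0 h') mulr_suml; apply: eq_bigr => g _; by rewrite mulrA.
rewrite pair_big_dep /=.
rewrite (reindex_onto (fun h'' : {ffun I -> W} => (upd h'' s0 (h s0), h'' s0))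
  (fun hg => upd hg.1 s0 hg.2)) /=; last first.
  move=> [h' g] /=; rewrite andbT => /forallP/(_ s0); rewrite (negbTE s0l) /= => /eqP <-.
  by rewrite upd_upd upd_id upd_same.
apply: eq_big => [h''|h'' _]; last first.
  rewrite upd_upd upd_id big_cons; congr (_ * (_ * _)).
  rewrite !big_seq; apply: eq_bigr => s sl; rewrite ffunE ifN //.
  by apply: contraNneq s0l => <-.
rewrite upd_upd upd_id eqxx !andbT; apply: eq_forallb => s; rewrite inE ffunE.
by case: (eqVneq s s0) => [->|_]; rewrite ?eqxx ?orbT.
Qed.

End TensorReproduce.

Section SpechtProjection.
Variables (n : nat) (la : seq nat).
Hypotheses (la_part : is_partition la) (la_sum : sumn la = n).
Notation C := algC.

Definition specht_proj : 'M[C]_(NT n) :=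
  pinvmx (row_base (specht_mx n la)) *m row_base (specht_mx n la).

Lemma specht_projK k (u : 'M[C]_(k, NT n)) : (u <= specht_mx n la)%MS -> u *m specht_proj = u.
Proof. by rewrite -(eq_row_base (specht_mx n la)) mulmxA => /mulmxKpV. Qed.

Lemma specht_proj_sub k (u : 'M[C]_(k, NT n)) : (u *m specht_proj <= specht_mx n la)%MS.
Proof. by rewrite mulmxA -(eq_row_base (specht_mx n la)) submxMl. Qed.

Lemma mul_tab_mx k (M : 'M[C]_(k, NT n)) (s : 'S_n) i f :
  (M *m tab_mx s) i (enum_rank f) = M i (enum_rank (pact f s)).
Proof.
rewrite mxE (bigD1 (enum_rank (pact f s))) //= !mxE enum_rankK enum_rankK.
rewrite (_ : tab_act _ _ = f); last by apply/ffunP => x; rewrite !ffunE permKV.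
rewrite eqxx mulr1 big1 ?addr0 // => j jf; rewrite !mxE enum_rankK.
rewrite (_ : tab_act _ _ == _ = false) ?mulr0 //; apply: contraNF jf => /eqP <-.
by apply/eqP; rewrite -[LHS]enum_valK; congr enum_rank; apply/ffunP => x; rewrite !ffunE permK.
Qed.

Lemma specht_stable (u : 'rV[C]_(NT n)) (s : 'S_n) :
  (u <= specht_mx n la)%MS -> (u *m tab_mx s <= specht_mx n la)%MS.
Proof.
rewrite !(young_vec_span la_part la_sum) => /(hwv_pact s); apply: eq_hwv => f.
by rewrite mul_tab_mx.
Qed.

Lemma specht_stablemx k (u : 'M[C]_(k, NT n)) (s : 'S_n) :
  (u <= specht_mx n la)%MS -> (u *m tab_mx s <= specht_mx n la)%MS.
Proof.
move=> /row_subP ule; apply/row_subP => i; rewrite row_mul.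
exact/specht_stable/ule.
Qed.

Lemma specht_charE (s : 'S_n) : specht_char n la s = \tr (specht_proj *m tab_mx s).
Proof. by rewrite /specht_char mxtrace_mulC mulmxA. Qed.

(* The conjugate of the projection is again a projection onto the Specht module, which is
   defined over the integers; traces do not depend on the projection. *)
Lemma specht_char_real (s : 'S_n) : (specht_char n la s)^* = specht_char n la s.
Proof.
have cj_specht : map_mx Num.conj (specht_mx n la) = specht_mx n la.
  apply/matrixP => i j; rewrite !mxE !summxE rmorph_sum; apply: eq_bigr => p _.
  by rewrite !mxE rmorphM rmorphXn rmorphN1 rmorph_nat.
have cj_tab : map_mx Num.conj (tab_mx s) = tab_mx s.
  by apply/matrixP => i j; rewrite !mxE rmorph_nat.
set Q := map_mx Num.conj specht_proj.
have Qsub k (u : 'M[C]_(k, NT n)) : (u *m Q <= specht_mx n la)%MS.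
  apply: submx_trans (submxMl _ _) _; rewrite -cj_specht map_submx.
  by rewrite -[specht_proj]mul1mx specht_proj_sub.
have QK k (u : 'M[C]_(k, NT n)) : (u <= specht_mx n la)%MS -> u *m Q = u.
  move=> ule; have := @specht_projK _ (map_mx Num.conj u).
  rewrite -{1}cj_specht map_submx => /(_ ule)/(congr1 (map_mx Num.conj)).
  rewrite map_mxM -/Q.
  by rewrite (_ : map_mx _ (map_mx _ u) = u) //; apply/matrixP => i j; rewrite !mxE; apply: conjCK.
rewrite specht_charE; transitivity (\tr (Q *m tab_mx s)).
  by rewrite -[in RHS]cj_tab /Q -map_mxM trace_map_mx.
have Qproj : Q *m specht_proj = Q by apply: specht_projK; rewrite -[Q]mul1mx Qsub.
rewrite -{1}Qproj -mulmxA mxtrace_mulC QK //; apply: specht_stablemx.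
by rewrite -[specht_proj]mul1mx specht_proj_sub.
Qed.

End SpechtProjection.

(** The S_n-invariants in the tensor product of the highest weight spaces: lying in the tensor
    product is expressed slot by slot, all other slots being fixed. *)
Definition tensor_hwv (I : finType) (R n : nat) (la : I -> nat -> nat)
    (v : {ffun I -> {ffun 'I_n -> 'I_R}} -> algC) : Prop :=
  (forall (s : 'S_n) (h : {ffun I -> {ffun 'I_n -> 'I_R}}),
     v [ffun i => pact (h i) s] = v h) /\
  forall i (h : {ffun I -> {ffun 'I_n -> 'I_R}}), hwv (la i) (fun g => v (upd h i g)).

Section KroneckerRank.
Variables (I : finType) (n : nat) (la : I -> seq nat).
Hypotheses (la_part : forall i, is_partition (la i)) (la_sum : forall i, sumn (la i) = n).
Notation C := algC.
Notation word := (tabloid n).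
Notation TI := {ffun I -> tabloid n}.
Implicit Types (h : TI).

Let Pi i (k g : word) : C := specht_proj n (la i) (enum_rank k) (enum_rank g).

(** The average over S_n of the group action composed with the tensor product of the Specht
    projections. It projects onto the invariants, so its rank is their dimension while its trace is
    the mean of the product of the characters. *)
Definition kron_proj : 'M[C]_#|{: TI}| :=
  \matrix_(j, k) ((#|{: 'S_n}|%:R)^-1 *
    \sum_(s : 'S_n) \prod_i Pi i ((enum_val j : TI) i) (pact ((enum_val k : TI) i) s)).

Let vec (u : 'rV[C]_#|{: TI}|) (h : TI) : C := u 0 (enum_rank h).

Lemma kron_proj_trace :
  \tr kron_proj = (#|{: 'S_n}|%:R)^-1 * \sum_(s : 'S_n) \prod_i specht_char n (la i) s.
Proof.
rewrite /mxtrace (reindex_onto enum_rank enum_val) => [|j _]; last exact: enum_valK.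
under eq_bigl => h do rewrite enum_rankK eqxx.
under eq_bigr => h _ do rewrite mxE enum_rankK.
rewrite -mulr_sumr exchange_big; congr (_ * _); apply: eq_bigr => s _ /=.
under [RHS]eq_bigr => i _ do rewrite specht_charE.
rewrite -(bigA_distr_bigA (fun i k => Pi i k (pact k s))); apply: eq_bigr => i _.
rewrite /mxtrace (reindex_onto enum_rank enum_val) => [|j _]; last exact: enum_valK.
by apply: eq_big => [k|k _]; rewrite ?enum_rankK ?eqxx // mul_tab_mx.
Qed.

Lemma Pi_hwv i k s : hwv (nth 0%N (la i)) (fun g => Pi i k (pact g s)).
Proof.
apply: (@hwv_pact _ _ _ (Pi i k)).
apply: (@eq_hwv _ _ _ (fun g => row (enum_rank k) (specht_proj n (la i)) 0 (enum_rank g))).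
  by move=> g; rewrite mxE.
apply/young_vec_span => //; rewrite -[specht_proj _ _]mul1mx row_mul; exact: specht_proj_sub.
Qed.

Lemma Pi_reproduce i (v : word -> C) : hwv (nth 0%N (la i)) v ->
  forall f, v f = \sum_g v g * Pi i g f.
Proof.
move=> hv f; pose u : 'rV[C]_(NT n) := \row_j v (enum_val j).
have uE g : u 0 (enum_rank g) = v g by rewrite mxE enum_rankK.
have uspan : (u <= specht_mx n (la i))%MS.
  by apply/young_vec_span => //; apply: eq_hwv hv => g; rewrite uE.
rewrite -uE -[in LHS](specht_projK uspan) mxE.
rewrite (reindex_onto enum_rank enum_val) => [|j _]; last exact: enum_valK.
by apply: eq_big => [g|g _]; rewrite ?enum_rankK ?eqxx // uE.
Qed.

Lemma vec_kron_proj u h : vec (u *m kron_proj) h = (#|{: 'S_n}|%:R)^-1 *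
  \sum_(s : 'S_n) \sum_h' vec u h' * \prod_i Pi i (h' i) (pact (h i) s).
Proof.
rewrite /vec mxE (reindex_onto enum_rank enum_val) => [|j _]; last exact: enum_valK.
under eq_bigl => h' do rewrite enum_rankK eqxx.
under eq_bigr => h' _ do rewrite mxE !enum_rankK mulrCA mulr_sumr.
by rewrite -mulr_sumr exchange_big.
Qed.

Lemma kron_proj_image u : tensor_hwv (fun i => nth 0%N (la i)) (vec (u *m kron_proj)).
Proof.
split=> [t h|i0 h].
  rewrite !vec_kron_proj; congr (_ * _).
  rewrite [RHS](reindex_inj (mulIg t)) /=; apply: eq_bigr => s _; apply: eq_bigr => h' _.
  by congr (_ * _); apply: eq_bigr => i _; rewrite ffunE pactM.
pose c (k : 'S_n * TI) : C := (#|{: 'S_n}|%:R)^-1 *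
  (vec u k.2 * \prod_(i | i != i0) Pi i (k.2 i) (pact (h i) k.1)).
apply: (@eq_hwv _ _ _ (fun g => \sum_k c k * Pi i0 (k.2 i0) (pact g k.1))) => [g|]; last first.
  by apply: hwv_sum => k; apply: Pi_hwv.
rewrite vec_kron_proj pair_big /= mulr_sumr; apply: eq_bigr => k _.
rewrite [in RHS](bigD1 i0) //= upd_same /c -!mulrA; congr (_ * (_ * _)); rewrite mulrC.
by congr (_ * _); apply: eq_bigr => i ii0; rewrite ffunE (negbTE ii0).
Qed.

Lemma kron_proj_fix u : tensor_hwv (fun i => nth 0%N (la i)) (vec u) -> u *m kron_proj = u.
Proof.
case=> uinv uslice; apply/rowP => j; rewrite -[j]enum_valK -!/(vec _ _) vec_kron_proj.
set h := enum_val j.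
rewrite (eq_bigr (fun=> vec u h)) => [|s _].
  rewrite sumr_const -[vec u h *+ _]mulr_natl mulKf // pnatr_eq0 -lt0n.
  by apply/card_gt0P; exists 1%g.
rewrite -(uinv s) (@tensor_reproduce _ _ _ Pi (vec u)) => [|i h1].
  by apply: eq_bigr => h' _; congr (_ * _); apply: eq_bigr => i _; rewrite ffunE.
by rewrite -{1}[h1](upd_id h1 i) (Pi_reproduce (uslice i h1)).
Qed.

Lemma has_dim_tensor_hwv :
  has_dim (fun u => tensor_hwv (fun i => nth 0%N (la i)) (vec u)) (\rank kron_proj) /\
  \tr kron_proj = (\rank kron_proj)%:R.
Proof.
have subP u : (u <= kron_proj)%MS <-> tensor_hwv (fun i => nth 0%N (la i)) (vec u).
  split=> [/submxP[w ->]|/kron_proj_fix <-]; [exact: kron_proj_image | exact: submxMl].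
split; last first.
  apply: mxtrace_idempotent; apply/row_matrixP => i; rewrite row_mul kron_proj_fix //.
  by apply/subP/row_sub.
apply: (@has_dim_bij _ _ _ (fun u => (u <= kron_proj)%MS) _ id) => // [|x|y|].
- by split=> [|a x y xP yP]; rewrite ?sub0mx // addmx_sub ?scalemx_sub.
- by move=> /subP.
- by move=> /subP; exists y.
- exact: has_dim_row_space.
Qed.

End KroneckerRank.

(** * Independence of the number of letters *)

Section ChangeRows.
Variables (n r r' : nat).
Notation C := algC.

Definition cast_word (g : {ffun 'I_n -> 'I_r'.+1}) : {ffun 'I_n -> 'I_r.+1} :=
  [ffun x => inord (g x)].

Definition bounded k (g : {ffun 'I_n -> 'I_r'.+1}) : bool := [forall x, g x < k]%N.

Lemma hwv0 R m la : hwv la (fun _ : {ffun 'I_m -> 'I_R} => 0 : C).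
Proof. by split=> [f|i j _ f]; [rewrite eqxx | rewrite big1]. Qed.

Lemma content_cast k g (i : 'I_r'.+1) : (k <= r.+1)%N -> bounded k g -> (i < k)%N ->
  content (cast_word g) (inord i) = content g i.
Proof.
move=> kr /forallP gk ik; apply: eq_card => x; rewrite !inE ffunE -!val_eqE /=.
by rewrite !inordK ?(leq_trans _ kr).
Qed.

Lemma hwv_change_rows k la (v : {ffun 'I_n -> 'I_r.+1} -> C) :
  (k <= r.+1)%N -> (forall i, (k <= i)%N -> la i = 0%N) -> hwv la v ->
  hwv la (fun g => if bounded k g then v (cast_word g) else 0).
Proof.
move=> kr la0 [v1 v2]; split=> [g|i j ij g].
  case: ifP => [gk vg i|]; last by rewrite eqxx.
  have [ik|ki] := ltnP i k.
    by rewrite -(content_cast kr gk ik) v1 // inordK // (leq_trans ik).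
  rewrite la0 //; apply: eq_card0 => x; rewrite inE; apply/negbTE.
  by rewrite -val_eqE /= neq_ltn (leq_trans (forallP gk x)).
have [jk|kj] := ltnP j k; last first.
  apply: big1 => x _; rewrite ifF //; apply/negbTE/forallPn; exists x.
  by rewrite upd_same -leqNgt.
have ik := ltn_trans ij jk.
have [gk|] := boolP (bounded k g); last first.
  move=> /forallPn[y gy]; apply: big1 => x gx; rewrite ifF //.
  apply/negbTE/forallPn; exists y; rewrite ffunE; case: eqVneq => // yx.
  by rewrite yx (eqP gx) ik in gy.
rewrite -[RHS](v2 (inord i) (inord j) _ (cast_word g)); last first.
  by rewrite !inordK ?(leq_trans _ kr).
apply: eq_big => [x|x gx].
  rewrite ffunE -!val_eqE /= !inordK ?(leq_trans _ kr) //.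
  exact: (forallP gk).
rewrite ifT; last by apply/forallP => y; rewrite ffunE; case: eqP => // _; apply: (forallP gk).
by congr v; apply/ffunP => y; rewrite !ffunE; case: eqP.
Qed.

End ChangeRows.

Section TensorChangeRows.
Variables (I : finType) (n r r' : nat) (sz : I -> nat) (la : I -> nat -> nat).
Notation C := algC.
Hypothesis la_sz : forall i k, (sz i <= k)%N -> la i k = 0%N.

Definition cast_tensor (R R' : nat) (h : {ffun I -> {ffun 'I_n -> 'I_R'.+1}}) :
  {ffun I -> {ffun 'I_n -> 'I_R.+1}} := [ffun i => cast_word R (h i)].

(** Specht modules use [n.+1] letters, polynomials a number of letters independent of [n]. A highest
    weight vector is supported on words whose letters index actual rows of its partition, so
    restricting to those words and extending by 0 loses nothing. *)
Definition change_rows (R R' : nat) (v : {ffun I -> {ffun 'I_n -> 'I_R.+1}} -> C)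
    (h : {ffun I -> {ffun 'I_n -> 'I_R'.+1}}) : C :=
  if [forall i, bounded (sz i) (h i)] then v (cast_tensor R h) else 0.

Lemma tensor_hwv_change_rows (v : {ffun I -> {ffun 'I_n -> 'I_r.+1}} -> C) :
  (forall i, (sz i <= r.+1)%N) -> tensor_hwv la v -> tensor_hwv la (@change_rows r r' v).
Proof.
move=> szr [vinv vsl]; split=> [s h|i h].
  rewrite /change_rows; congr (if _ then _ else _).
    apply: eq_forallb => i; rewrite ffunE; apply/forallP/forallP => H x.
      by have := H (s^-1%g x); rewrite ffunE permKV.
    by rewrite ffunE.
  by rewrite -[RHS](vinv s); congr v; apply/ffunP => i; apply/ffunP => x; rewrite !ffunE.
have [hb|hb] := boolP [forall j, (j != i) ==> bounded (sz j) (h j)]; last first.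
  apply: eq_hwv (hwv0 _ _ _) => g; rewrite /change_rows ifF //; apply/negbTE.
  move: hb => /forallPn[j]; rewrite negb_imply => /andP[ji hj].
  by apply/forallPn; exists j; rewrite ffunE (negbTE ji).
apply: (@eq_hwv _ _ _ (fun g => if bounded (sz i) g
    then v (upd (cast_tensor r h) i (cast_word r g)) else 0)) => [g|]; last first.
  by apply: (@hwv_change_rows _ _ r' _ _ (fun g => v (upd (cast_tensor r h) i g)) (szr i)) => // k;
    apply: la_sz.
rewrite /change_rows (_ : [forall _, _] = bounded (sz i) g); last first.
  apply/forallP/idP => [/(_ i)|gb j]; first by rewrite upd_same.
  by rewrite ffunE; case: eqVneq => [->//|ji]; apply: (implyP (forallP hb j)).
case: ifP => // _; congr v; apply/ffunP => j; rewrite !ffunE.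
by case: eqP.
Qed.

Lemma tensor_hwv_bounded R (v : {ffun I -> {ffun 'I_n -> 'I_R.+1}} -> C) h :
  tensor_hwv la v -> v h != 0 -> [forall i, bounded (sz i) (h i)].
Proof.
move=> [_ vsl] vh; apply/forallP => i; apply/forallP => x; rewrite ltnNge; apply/negP => szh.
have [+ _] := vsl i h => /(_ (h i)); rewrite upd_id => /(_ vh (h i x)).
by rewrite la_sz // => /card0_eq/(_ x); rewrite inE eqxx.
Qed.

Lemma change_rowsK (v : {ffun I -> {ffun 'I_n -> 'I_r.+1}} -> C) :
  (forall i, (sz i <= r'.+1)%N) -> tensor_hwv la v ->
  @change_rows r' r (@change_rows r r' v) =1 v.
Proof.
move=> szr' hv h; rewrite {1}/change_rows.
case: ifPn => hb; last first.
  by apply/esym/eqP; apply: contraNT hb; apply: tensor_hwv_bounded.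
rewrite /change_rows ifT.
  congr v; apply/ffunP => i; apply/ffunP => x; rewrite !ffunE; apply: val_inj => /=.
  have hx := forallP (forallP hb i) x.
  by rewrite (inordK (leq_trans hx (szr' i))) inordK.
apply/forallP => i; apply/forallP => x; rewrite !ffunE.
have hx := forallP (forallP hb i) x.
by rewrite inordK ?(leq_trans hx).
Qed.

End TensorChangeRows.

(** * Highest weight polynomials *)

Section WordPolynomials.
Variables (A : finType) (n : nat).
Notation C := algC.
Notation R := {mpoly C[#|A|]}.
Notation word := {ffun 'I_n -> A}.
Implicit Types (f g : word) (v : word -> C) (p : R).

Definition wmon f : 'X_{1..#|A|} := (\sum_x U_(enum_rank (f x)))%MM.

Definition wpoly v : R := \sum_f v f *: \prod_x vr (f x).

Lemma prod_vr f : \prod_x vr (f x) = 'X_[wmon f].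
Proof. exact: mprodXE. Qed.

Lemma wmonE f a : wmon f (enum_rank a) = content f a.
Proof.
rewrite /wmon mnm_sumE /content -[RHS]sum1_card [RHS]big_mkcond /=; apply: eq_bigr => x _.
by rewrite mnm1E (inj_eq enum_rank_inj) inE; case: eqP.
Qed.

Lemma mdeg_wmon f : mdeg (wmon f) = n.
Proof.
rewrite mdeg_sum (eq_bigr (fun=> 1%N)) => [|x _]; last by rewrite mdeg1.
by rewrite sum_nat_const card_ord muln1.
Qed.

Lemma wmon_pact f s : wmon (pact f s) = wmon f.
Proof.
by apply/mnmP => i; rewrite -[i]enum_valK !wmonE content_pact.
Qed.

Lemma wmon_eqP f g : wmon f = wmon g -> exists s, g = pact f s.
Proof. by move=> fg; apply: content_eqP => a; rewrite -!wmonE fg. Qed.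

Lemma wmon_surj m : mdeg m = n -> exists f, wmon f = m.
Proof.
move=> mn; suff [l sl ml] : exists2 l : seq A, size l = n & m = (\sum_(a <- l) U_(enum_rank a))%MM.
  case: l sl ml => [|a0 l] sl ->.
    have n0 (x : 'I_n) : False by case: x => x; rewrite -sl.
    exists [ffun x => False_rect A (n0 x)].
    by rewrite big_nil /wmon big1 // => x; case: (n0 x).
  exists [ffun x : 'I_n => nth a0 (a0 :: l) x].
  rewrite /wmon (big_nth a0) big_mkord -sl; apply: eq_bigr => x _; rewrite ffunE.
  by [].
elim: n m mn => [|k IHk] m mk.
  by exists [::] => //; rewrite big_nil; apply/eqP; rewrite -mdeg_eq0 mk.
have [i mi] : exists i, m i != 0%N.
  apply/existsP; apply: contraPT mk; rewrite negb_exists => /forallP m0.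
  rewrite mdegE big1 // => i _; apply/eqP; move: (m0 i); by rewrite negbK.
have [|l sl ml] := IHk (m - U_(i))%MM.
  have := mdegD (m - U_(i)) U_(i); rewrite submK ?lep1mP // mk mdeg1; lia.
exists (enum_val i :: l); first by rewrite /= sl.
by rewrite big_cons enum_valK -ml addmC submK // lep1mP.
Qed.

Lemma mcoeff_wpoly v m : (wpoly v)@_m = \sum_(f | wmon f == m) v f.
Proof.
rewrite /wpoly linear_sum /= [RHS]big_mkcond; apply: eq_bigr => f _.
by rewrite mcoeffZ prod_vr mcoeffX; case: eqP; rewrite ?mulr1 ?mulr0.
Qed.

(** Words with the same monomial are rearrangements of each other, so the coefficient of a monomial
    is a positive multiple of the common value of [v] on them. *)
Lemma wpoly_inj v : (forall s f, v (pact f s) = v f) -> wpoly v = 0 -> forall f, v f = 0.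
Proof.
move=> vinv v0 f; have /eqP := mcoeff_wpoly v (wmon f); rewrite v0 mcoeff0.
rewrite (eq_bigr (fun=> v f)) => [|g /eqP/esym/wmon_eqP[s ->] //].
rewrite sumr_const eq_sym mulrn_eq0 => /orP[N0|/eqP //].
have : (0 < #|[pred g | wmon g == wmon f]|)%N.
  by apply/card_gt0P; exists f; rewrite inE eqxx.
by rewrite lt0n => /negP[].
Qed.

Lemma wpoly_surj p : (forall m, p@_m != 0 -> mdeg m = n) ->
  exists2 v, (forall s f, v (pact f s) = v f) & p = wpoly v.
Proof.
move=> pn; exists (fun f => p@_(wmon f) / #|[pred g | wmon g == wmon f]|%:R).
  by move=> s f; rewrite wmon_pact.
apply/mpolyP => m; rewrite mcoeff_wpoly.
have [/(wmon_surj)[f <-]|mn] := eqVneq (mdeg m) n; last first.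
  rewrite big_pred0 => [|f]; first by apply/eqP/idPn => /pn/eqP; rewrite (negbTE mn).
  by apply: contraNF mn => /eqP <-; rewrite mdeg_wmon.
pose N := #|[pred g | wmon g == wmon f]|.
rewrite (eq_bigr (fun=> p@_(wmon f) / N%:R)) => [|g /eqP gf]; last first.
  by rewrite /N gf.
rewrite sumr_const -[RHS]mulr_natr -/N divfK // pnatr_eq0 -lt0n.
by apply/card_gt0P; exists f; rewrite inE eqxx.
Qed.

Lemma lvf_wpoly L v :
  lvf L (wpoly v) = wpoly (fun g => \sum_x \sum_b L (g x) b * v (upd g x b)).
Proof.
transitivity (\sum_(f : word) \sum_x \sum_a (v f * L a (f x)) *: \prod_y vr (upd f x a y)).
  rewrite linear_sum; apply: eq_bigr => f _; rewrite linearZ /= lvf_prod scaler_sumr.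
  apply: eq_bigr => x _; rewrite lvf_vr mulr_suml scaler_sumr; apply: eq_bigr => a _.
  rewrite -scalerAl scalerA [in RHS](bigD1 x) //= upd_same; congr (_ *: (_ * _)).
  by apply: eq_bigr => y yx; rewrite ffunE (negbTE yx).
transitivity (\sum_(g : word) \sum_x \sum_b (L (g x) b * v (upd g x b)) *: \prod_y vr (g y)).
  rewrite exchange_big [RHS]exchange_big; apply: eq_bigr => x _ /=; rewrite !pair_big /=.
  (* Exchanges the letter at [x] with the summation index. *)
  pose phi (gb : word * A) := (upd gb.1 x gb.2, gb.1 x).
  have phiK : involutive phi by move=> [g b]; rewrite /phi /= upd_same upd_upd upd_id.
  rewrite (reindex_inj (inv_inj phiK)) /=; apply: eq_bigr => -[g b] _ /=.
  by rewrite upd_same upd_upd upd_id mulrC.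
apply: eq_bigr => g _; rewrite scaler_suml; apply: eq_bigr => x _.
by rewrite scaler_suml.
Qed.

End WordPolynomials.

Lemma lvf_sum (A J : finType) (L : J -> A -> A -> algC) p :
  lvf (fun a b => \sum_j L j a b) p = \sum_j lvf (L j) p.
Proof.
rewrite /lvf [RHS]exchange_big; apply: eq_bigr => a _ /=.
by rewrite [RHS]exchange_big; apply: eq_bigr => b _ /=; rewrite scaler_suml.
Qed.

Lemma eq_lvf (A : finType) (L L' : A -> A -> algC) p :
  (forall a b, L a b = L' a b) -> lvf L p = lvf L' p.
Proof. by move=> LL'; rewrite /lvf; do 2!apply: eq_bigr => ? _; rewrite LL'. Qed.

Lemma mcoeff_euler (A : finType) (p : {mpoly algC[#|A|]}) m :
  (lvf (fun a b => (a == b)%:R) p)@_m = (mdeg m)%:R * p@_m.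
Proof.
have lvfX m' : lvf (fun a b : A => (a == b)%:R) 'X_[m'] = (mdeg m')%:R *: 'X_[algC, m'].
  rewrite mdegE natr_sum scaler_suml (reindex_onto enum_rank enum_val) => [|i _]; last first.
    exact: enum_valK.
  apply: eq_big => [a|a _]; first by rewrite enum_rankK eqxx.
  rewrite (bigD1 a) //= eqxx scale1r big1 ?addr0 => [|b ba]; last first.
    by rewrite eq_sym (negbTE ba) scale0r.
  rewrite /vr /dr mderivX -scalerAr.
  have [->|m0] := eqVneq (m' (enum_rank a)) 0%N; first by rewrite !scale0r.
  by rewrite -mpolyXD addmC submK // lep1mP.
have -> : lvf (fun a b : A => (a == b)%:R) p =
    \sum_(m' <- msupp p) p@_m' *: ((mdeg m')%:R *: 'X_[m']).
  by rewrite {1}[p]mpolyE linear_sum; apply: eq_bigr => m' _; rewrite linearZ /= lvfX.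
rewrite [in RHS](mpolyE p) !(raddf_sum (mcoeff m)) mulr_sumr; apply: eq_bigr => m' _.
by rewrite /= !mcoeffZ mcoeffX; case: eqP => [->|_]; rewrite ?mulr0 // mulrCA.
Qed.

Section HighestWeightPolynomials.
Variables (I : finType) (N : nat).
Notation C := algC.
Notation X := {ffun I -> 'I_N}.
Implicit Types (ct : I -> nat -> nat) (p q : {mpoly C[#|X|]}).

(* [lvf (xraise s i j)] is the action of the elementary matrix E_ij in the s-th factor of
   the product of the gl_N on the tensor product of the standard representations. *)
Definition xraise (s : I) (i j : 'I_N) (u' u : X) : C :=
  ((u s == j) && (u' == upd u s i))%:R.

Definition hwp ct p : Prop :=
  (forall s (i j : 'I_N), (i < j)%N -> lvf (xraise s i j) p = 0) /\
  forall s (i : 'I_N), lvf (xraise s i i) p = (ct s i)%:R *: p.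

Lemma subspace_hwp ct : subspace (hwp ct).
Proof.
split=> [|a p q [p1 p2] [q1 q2]]; first by split=> *; rewrite linear0 ?scaler0.
split=> [s i j ij|s i]; first by rewrite linearP /= p1 // q1 // scaler0 addr0.
by rewrite linearP /= p2 q2 scalerDr !scalerA mulrC.
Qed.

Lemma hwpM ct ct' p q : hwp ct p -> hwp ct' q -> hwp (fun s i => ct s i + ct' s i)%N (p * q).
Proof.
move=> [p1 p2] [q1 q2]; split=> [s i j ij|s i]; rewrite lvfM.
  by rewrite p1 // q1 // mul0r mulr0 addr0.
by rewrite p2 q2 -scalerAl -scalerAr -scalerDl natrD.
Qed.

Lemma eq_hwp ct ct' p : (forall s (i : 'I_N), ct s i = ct' s i) -> hwp ct p -> hwp ct' p.
Proof. by move=> ctE [p1 p2]; split=> // s i; rewrite p2 ctE. Qed.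

(** Summed over [i], the E_ii of a single factor give the Euler operator, so the total weight of any
    factor is the degree. *)
Lemma hwp_homog ct n s p : (\sum_(i < N) ct s i)%N = n -> hwp ct p ->
  forall m, p@_m != 0 -> mdeg m = n.
Proof.
move=> ctn [_ p2] m pm.
have : lvf (fun a b => (a == b)%:R) p = n%:R *: p.
  rewrite -ctn natr_sum scaler_suml; under eq_bigr => i _ do rewrite -p2.
  rewrite -lvf_sum; apply: eq_lvf => u' u; rewrite /xraise (bigD1 (u s)) //= eqxx upd_id.
  by rewrite big1 ?addr0 // => i ius; rewrite eq_sym (negbTE ius).
move=> /(congr1 (mcoeff m)); rewrite mcoeff_euler mcoeffZ => /(mulIf pm)/eqP.
by rewrite eqr_nat => /eqP.
Qed.

Variable n : nat.

(** The rearrangement of the n-th tensor power of a tensor product into a tensor product of n-th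
    tensor powers. *)
Definition swap (f : {ffun 'I_n -> X}) : {ffun I -> {ffun 'I_n -> 'I_N}} :=
  [ffun s => [ffun x => f x s]].

Definition unswap (h : {ffun I -> {ffun 'I_n -> 'I_N}}) : {ffun 'I_n -> X} :=
  [ffun x => [ffun s => h s x]].

Lemma swapK : cancel swap unswap.
Proof. by move=> f; apply/ffunP => x; apply/ffunP => s; rewrite !ffunE. Qed.

Lemma unswapK : cancel unswap swap.
Proof. by move=> f; apply/ffunP => x; apply/ffunP => s; rewrite !ffunE. Qed.

Lemma swap_upd g x s j :
  swap (upd g x (upd (g x) s j)) = upd (swap g) s (upd (swap g s) x j).
Proof.
apply/ffunP => t; apply/ffunP => y; rewrite !ffunE.
case: (eqVneq y x) => [->|yx]; rewrite ?ffunE.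
  by case: (eqVneq t s) => [_|ts]; rewrite !ffunE ?eqxx.
by case: (eqVneq t s) => [ts|ts]; rewrite !ffunE ?(negbTE yx) ?ts.
Qed.

Lemma sum_xraise (v : {ffun 'I_n -> X} -> C) s i j (g : {ffun 'I_n -> X}) :
  \sum_x \sum_b xraise s i j (g x) b * v (upd g x b) =
  \sum_(x | swap g s x == i) v (upd g x (upd (g x) s j)).
Proof.
rewrite [RHS]big_mkcond; apply: eq_bigr => x _; rewrite !ffunE.
case: eqP => [gx|gx]; last first.
  apply: big1 => b _; rewrite /xraise; case: (b s == j) => /=; last by rewrite mul0r.
  by case: eqP => [gb|]; rewrite ?mul0r //; case: gx; rewrite gb upd_same.
rewrite (bigD1 (upd (g x) s j)) //= /xraise upd_same upd_upd -gx upd_id !eqxx mul1r.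
rewrite big1 ?addr0 // => b bg; case: eqP => [bs|]; last by rewrite mul0r.
case: eqP => [gb|]; rewrite ?mul0r //.
by case/eqP: bg; rewrite gb upd_upd -bs upd_id.
Qed.

(** By [lvf_wpoly], E_ij acts on the underlying vector; the result is again S_n-invariant, so an
    equation between polynomials descends to vectors through [wpoly_inj]. *)
Lemma hwp_wpoly ct (w : {ffun I -> {ffun 'I_n -> 'I_N}} -> C) :
  (forall (s : 'S_n) (h : {ffun I -> {ffun 'I_n -> 'I_N}}),
     w [ffun i => pact (h i) s] = w h) ->
  hwp ct (wpoly (w \o swap)) <-> tensor_hwv ct w.
Proof.
move=> winv.
have inv (s : 'S_n) f : (w \o swap) (pact f s) = (w \o swap) f.
  rewrite /= -[RHS](winv s); congr w.
  by apply/ffunP => t; apply/ffunP => x; rewrite !ffunE.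
have inv_raise s i j (t : 'S_n) (f : {ffun 'I_n -> X}) :
    \sum_(x | swap (pact f t) s x == i) (w \o swap) (upd (pact f t) x (upd (pact f t x) s j)) =
    \sum_(x | swap f s x == i) (w \o swap) (upd f x (upd (f x) s j)).
  rewrite [RHS](reindex_inj (@perm_inj _ t)) /=; apply: eq_big => [x|x _].
    by rewrite !ffunE.
  by rewrite ffunE upd_pact; apply: inv.
have lvfE s i j : lvf (xraise s i j) (wpoly (w \o swap)) =
    wpoly (fun g : {ffun 'I_n -> X} =>
      \sum_(x | swap g s x == i) (w \o swap) (upd g x (upd (g x) s j))).
  rewrite lvf_wpoly; apply: eq_bigr => g _; by rewrite sum_xraise.
have diagE s i (f : {ffun 'I_n -> X}) :
    \sum_(x | swap f s x == i) (w \o swap) (upd f x (upd (f x) s i)) =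
    (content (swap f s) i)%:R * w (swap f).
  rewrite mulr_natl /content -sumr_const; apply: eq_big => [x|x]; first by rewrite inE.
  by rewrite !ffunE => /eqP <-; rewrite !upd_id.
split=> [[p1 p2]|[_ hw]].
  split=> // s h; split=> [g wg i|i j ij g].
    pose c (f : {ffun 'I_n -> X}) := ((content (swap f s) i)%:R - (ct s i)%:R) * w (swap f).
    have c0 : c (unswap (upd h s g)) = 0.
      apply: wpoly_inj => [t f|].
        rewrite /c -[w _]/((w \o swap) _) inv /=; congr ((_%:R - _) * _).
        rewrite -[in RHS](content_pact _ t) !ffunE; congr content.
        by apply/ffunP => x; rewrite !ffunE.
      have /eqP := p2 s i; rewrite lvfE -subr_eq0 => /eqP <-.
      rewrite /wpoly scaler_sumr -sumrB; apply: eq_bigr => f _.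
      by rewrite diagE scalerA -scalerBl /c mulrBl.
    move/eqP: c0; rewrite /c unswapK mulf_eq0 (negbTE wg) orbF subr_eq0 eqr_nat => /eqP.
    by rewrite upd_same.
  have := @wpoly_inj _ _ _ (inv_raise s i j) _ (unswap (upd h s g)).
  rewrite -lvfE p1 // => /(_ erefl) z; rewrite -[RHS]z unswapK upd_same.
  by apply: eq_bigr => x _ /=; rewrite swap_upd unswapK upd_same upd_upd.
split=> [s i j ij|s i]; rewrite lvfE.
  apply: big1 => g _; rewrite (_ : \sum_(x | _) _ = 0) ?scale0r //.
  have [_ hw2] := hw s (swap g); rewrite -[RHS](hw2 i j ij (swap g s)).
  by apply: eq_bigr => x _; rewrite /= swap_upd.
rewrite scaler_sumr; apply: eq_bigr => f _; rewrite diagE scalerA /=; congr (_ *: _).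
have [/eqP wf|wf] := boolP (w (swap f) == 0); first by rewrite wf !mulr0.
have [hw1 _] := hw s (swap f); move: (hw1 (swap f s)); rewrite upd_id => /(_ wf) ->.
by [].
Qed.

End HighestWeightPolynomials.

Lemma eq_tensor_hwv (I : finType) (R n : nat) (la : I -> nat -> nat)
    (v w : {ffun I -> {ffun 'I_n -> 'I_R}} -> algC) :
  v =1 w -> tensor_hwv la v -> tensor_hwv la w.
Proof.
move=> vw [vinv vsl]; split=> [s h|i h]; first by rewrite -!vw.
by apply: eq_hwv (vsl i h) => g; rewrite vw.
Qed.

Lemma tensor_hwv_lin (I : finType) (R n : nat) (la : I -> nat -> nat) a
    (v w : {ffun I -> {ffun 'I_n -> 'I_R}} -> algC) :
  tensor_hwv la v -> tensor_hwv la w -> tensor_hwv la (fun h => a * v h + w h).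
Proof.
move=> [vinv vsl] [winv wsl]; split=> [s h|i h]; first by rewrite vinv winv.
apply: (@eq_hwv _ _ _ (fun g => a * v (upd h i g) + 1 * w (upd h i g))) => [g|].
  by rewrite mul1r.
by apply: hwv_lin2; [apply: vsl | apply: wsl].
Qed.

Lemma sum_nth_sumn N l : (size l <= N)%N -> (\sum_(i < N) nth 0 l i = sumn l)%N.
Proof.
elim: l N => [|a l IHl] [|N] //= sl; first by rewrite big_ord0.
  by rewrite big1 // => i _; rewrite nth_nil.
by rewrite big_ord_recl /= (eq_bigr (fun i : 'I_N => nth 0%N l i)) // IHl.
Qed.

(** The factor [s0] makes [I] nonempty, so that the weight fixes the degree of the polynomials. *)
Lemma has_dim_hwp (I : finType) (s0 : I) (N n : nat) (la : I -> seq nat) :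
  (forall i, is_partition (la i)) -> (forall i, sumn (la i) = n) ->
  (forall i, (size (la i) <= N.+1)%N) ->
  has_dim (@hwp I N.+1 (fun s => nth 0%N (la s))) (\rank (kron_proj n la)).
Proof.
move=> la_part la_sum la_size; pose sz i := size (la i).
have la0 i k : (sz i <= k)%N -> nth 0%N (la i) k = 0%N by apply: nth_default.
have szn i : (sz i <= n.+1)%N.
  by rewrite ltnW // ltnS -(la_sum i) size_leq_sumn //; case/andP: (la_part i).
pose TI := {ffun I -> tabloid n}.
pose vec (u : 'rV[algC]_#|{: TI}|) (h : TI) := u 0 (enum_rank h).
pose f u := wpoly (@change_rows I n sz n N (vec u) \o @swap I N.+1 n).
have [hd _] := has_dim_tensor_hwv la_part la_sum.
have inv_of R (w : {ffun I -> {ffun 'I_n -> 'I_R}} -> algC) la' : tensor_hwv la' w ->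
    forall (s : 'S_n) (h : {ffun I -> {ffun 'I_n -> 'I_R}}), w [ffun i => pact (h i) s] = w h.
  by case.
apply: (has_dim_bij (f := f)) hd => [a x y||x hx|x hx fx0|p hp].
- rewrite /f /wpoly scaler_sumr -big_split; apply: eq_bigr => g _ /=.
  rewrite scalerA -scalerDl /change_rows; congr (_ *: _).
  by case: ifP => _; rewrite ?mulr0 ?addr0 // /vec !mxE.
- split=> [|a x y hx hy]; last first.
    by apply: eq_tensor_hwv (tensor_hwv_lin a hx hy) => h; rewrite !mxE.
  apply: (@eq_tensor_hwv _ _ _ _ (fun=> 0)) => [h|]; first by rewrite mxE.
  by split=> // i h; apply: hwv0.
- have hw := tensor_hwv_change_rows N la0 szn hx.
  by apply/hwp_wpoly; [apply: inv_of hw | apply: hw].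
- have hw := tensor_hwv_change_rows N la0 szn hx.
  have w0 (h : {ffun I -> {ffun 'I_n -> 'I_N.+1}}) : change_rows sz (vec x) h = 0.
    rewrite -[h]unswapK; move: (unswap h).
    apply: (@wpoly_inj _ _ (change_rows sz (vec x) \o @swap I N.+1 n)) => // s g /=.
    rewrite -[RHS](inv_of _ _ _ hw s); congr (change_rows _ _ _).
    by apply/ffunP => t; apply/ffunP => y; rewrite !ffunE.
  apply/rowP => k; rewrite -[k]enum_valK mxE.
  rewrite -(change_rowsK (r' := N) la0 la_size hx) /change_rows.
  by case: ifP => // _; have := w0 (cast_tensor N (enum_val k)); rewrite /change_rows.
- have pn : forall m, p@_m != 0 -> mdeg m = n.
    by apply: (hwp_homog (s := s0)) hp; rewrite sum_nth_sumn.
  have [v vinv pE] := wpoly_surj pn.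
  pose w (h : {ffun I -> {ffun 'I_n -> 'I_N.+1}}) := v (unswap h).
  have winv (s : 'S_n) (h : {ffun I -> {ffun 'I_n -> 'I_N.+1}}) : w [ffun i => pact (h i) s] = w h.
    rewrite /w -[RHS](vinv s); congr v.
    by apply/ffunP => t; apply/ffunP => y; rewrite !ffunE.
  have pE' : p = wpoly (w \o @swap I N.+1 n).
    by rewrite pE; apply: eq_bigr => g _; rewrite /= /w swapK.
  have hw : tensor_hwv (fun s => nth 0%N (la s)) w.
    by apply/hwp_wpoly => //; rewrite -pE'.
  exists (\row_k change_rows sz w (enum_val k : TI)).
    apply: eq_tensor_hwv (tensor_hwv_change_rows n la0 la_size hw) => h.
    by rewrite mxE enum_rankK.
  rewrite pE'; apply: eq_bigr => g _ /=; congr (_ *: _).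
  rewrite -(change_rowsK (r' := n) la0 szn hw) /change_rows.
  by case: ifP => // _; rewrite /vec mxE enum_rankK.
Qed.

Definition triple (a b c : seq nat) (i : 'I_3) : seq nat := nth [::] [:: a; b; c] i.

Lemma tripleP (P : seq nat -> Prop) a b c : P a -> P b -> P c -> forall i, P (triple a b c i).
Proof. by move=> ? ? ? [[|[|[|]]]]. Qed.

Lemma kron_rank a b c : is_partition a -> is_partition b -> is_partition c ->
  sumn a = sumn b -> sumn b = sumn c ->
  kron a b c = (\rank (kron_proj (sumn a) (triple a b c)))%:R.
Proof.
move=> pa pb pc ab bc.
have part : forall i, is_partition (triple a b c i) by apply: (@tripleP is_partition).
have sum : forall i, sumn (triple a b c i) = sumn a.
  by apply: (@tripleP (fun l => sumn l = sumn a)); rewrite ?ab ?bc.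
have [_ <-] := has_dim_tensor_hwv part sum.
rewrite kron_proj_trace /kron /kron_n; congr (_ * _); apply: eq_bigr => s _.
by rewrite !big_ord_recl big_ord0 mulr1 /= mulrA specht_char_real ?ab ?bc.
Qed.

(** * Covariants and their specialization *)

Section ColumnDeterminant.
Variable N : nat.
Notation C := algC.
Notation cword := {ffun 'I_N -> 'I_N}.
Implicit Types (w : cword) (k m i j : 'I_N).

(* Only the letters [w m] with [m <= k] matter: [w] stands for a word of length k + 1. *)
Definition ext_word k w : cword := [ffun m : 'I_N => if (m <= k)%N then w m else m].

(** The sign of [w] on the positions 0, ..., k if it permutes them, and 0 otherwise: the coordinates
    of e_0 /\ ... /\ e_k. *)
Definition eps k w : C := \det (\matrix_(m, m') (ext_word k w m == m')%:R).

Lemma eps_inj k w : eps k w != 0 -> injective (ext_word k w).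
Proof.
move=> e0 m1 m2 em; apply/eqP; apply: contraNT e0 => m12.
by apply/eqP; apply: (determinant_alternate m12) => m; rewrite !mxE em.
Qed.

Lemma eps_bij k w : eps k w != 0 -> forall i, exists m, ext_word k w m = i.
Proof.
move=> /eps_inj/injF_bij[g _ gK] i; by exists (g i); rewrite gK.
Qed.

Lemma eps_id k : eps k [ffun m => m] = 1.
Proof.
rewrite -[RHS](det1 _ N); congr (\det _); apply/matrixP => m m'; rewrite !mxE !ffunE.
by case: ifP.
Qed.

Lemma eps_tperm k w m1 m2 : (m1 <= k)%N -> (m2 <= k)%N -> m1 != m2 ->
  eps k (pact w (tperm m1 m2)) = - eps k w.
Proof.
move=> m1k m2k m12; transitivity (\det (perm_mx (tperm m1 m2)) * eps k w); last first.
  by rewrite det_perm odd_tperm m12 expr1 mulN1r.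
rewrite -det_mulmx -row_permE; congr (\det _); apply/matrixP => m m'; rewrite !mxE !ffunE.
by case: (tpermP m1 m2 m) => [->|->|_ _]; rewrite ?m1k ?m2k.
Qed.

(** A nonzero term forces [j <= k], for otherwise the letter [j] would be repeated. The letter [i]
    then occurs at a second position, and exchanging the two positions fixes [w] but changes the
    sign. *)
Lemma eps_raise k w i j : (i < j)%N ->
  \sum_(m : 'I_N | (m <= k)%N && (w m == i)) eps k (upd w m j) = 0.
Proof.
move=> ij; pose u (w : cword) := \sum_(m : 'I_N | (m <= k)%N && (w m == i)) eps k (upd w m j).
apply/eqP/idPn; rewrite -/(u w) => uw.
have [m /andP[mk /eqP wm] em] : exists2 m : 'I_N, (m <= k)%N && (w m == i) & eps k (upd w m j) != 0.
  apply/exists_inP; apply: contraR uw; rewrite negb_exists_in => /forall_inP u0.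
  by apply/eqP/big1 => m /u0; rewrite negbK => /eqP.
have jk : (j <= k)%N.
  rewrite leqNgt; apply/negP => kj.
  have /(eps_inj em)/(congr1 val) /= : ext_word k (upd w m j) m = ext_word k (upd w m j) j.
    by rewrite !ffunE mk eqxx leqNgt kj.
  lia.
have [m2] := eps_bij em i; rewrite !ffunE; case: ifP => [m2k|m2k m2i]; last first.
  by rewrite m2i (ltnW (leq_trans ij jk)) in m2k.
case: eqVneq => [_ ji|m2m wm2]; first by rewrite ji ltnn in ij.
have wt : pact w (tperm m m2) = w.
  by apply/ffunP => y; rewrite ffunE; case: tpermP => // ->; rewrite wm wm2.
have : u w = - u w.
  rewrite -[in LHS]wt /u (reindex_inj (@perm_inj _ (tperm m m2))) /= -sumrN.
  apply: eq_big => [y|y /andP[yk _]].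
    by rewrite ffunE tpermK; congr (_ && _); case: tpermP => // ->; rewrite mk m2k.
  by rewrite upd_pact tpermK eps_tperm // eq_sym.
move/eqP; rewrite -addr_eq0 -mulr2n mulrn_eq0 /= => /eqP u0.
by rewrite u0 eqxx in uw.
Qed.

Lemma eps_diag k w i : eps k w != 0 -> #|[pred m : 'I_N | (m <= k)%N && (w m == i)]| = (i <= k)%N.
Proof.
move=> ew; have winj := eps_inj ew; have [m wm] := eps_bij ew i.
have [ik|ki] := leqP i k; last first.
  apply: eq_card0 => y; rewrite inE; apply/negP => /andP[yk /eqP wy].
  have /winj/(congr1 val) /= : ext_word k w y = ext_word k w i.
    by rewrite !ffunE yk wy leqNgt ki.
  lia.
rewrite -[RHS](card1 m); apply: eq_card => y; rewrite !inE; apply/andP/eqP => [[yk /eqP wy]|->].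
  by apply: winj; rewrite wm ffunE yk.
by move: wm; rewrite ffunE; case: ifP => // mk wm; [rewrite wm | move: mk; rewrite wm ik].
Qed.

End ColumnDeterminant.

Section Covariants.
Variables (I : finType) (N : nat).
Notation C := algC.
Notation X := {ffun I -> 'I_N}.
Notation cword := {ffun 'I_N -> 'I_N}.
Notation Z := (I * 'I_N * cword)%type.
Definition covar : finType := (X + Z)%type.
Definition covop_index : finType := (I * 'I_N * 'I_N + I * 'I_N)%type.

(* [inl u] is a coordinate of the tensor product of the copies of C^N, and [inr (s, k, w)] a
   coordinate of the (k+1)-st tensor power of the dual of the s-th copy, on which E_ij acts by
   - \sum_m [w m = i] z_(upd w m j). *)
Definition zlower (s : I) (i j : 'I_N) (z' z : Z) : nat :=
  let: (s', k', w') := z' in let: (s1, k, w) := z in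
  if (s' == s) && (s1 == s) && (k' == k)
  then (\sum_(m : 'I_N | (m <= k)%N) nat_of_bool ((w m == i) && (w' == upd w m j)))%N else 0%N.

Definition glact s i j (a b : covar) : C :=
  match a, b with
  | inl u', inl u => xraise s i j u' u
  | inr z', inr z => - (zlower s i j z' z)%:R
  | _, _ => 0
  end.

Definition zdeg (s : I) (k : 'I_N) (a b : covar) : C :=
  match b with
  | inl _ => 0
  | inr (s1, k1, w) => ((a == b) && (s1 == s) && (k1 == k))%:R
  end.

(** All E_ij, lowering ones included, so that the family is closed under adjoints, together with the
    operators measuring the degree in each kind of column variable. *)
Definition covop (t : covop_index) : covar -> covar -> C :=
  match t with inl (s, i, j) => glact s i j | inr (s, k) => zdeg s k end.

Definition covop_st (t : covop_index) : covop_index :=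
  match t with inl (s, i, j) => inl (s, j, i) | inr sk => inr sk end.

Lemma upd_swap (T1 T2 : finType) (u u' : {ffun T1 -> T2}) s i j :
  (u s == j) && (u' == upd u s i) = (u' s == i) && (u == upd u' s j).
Proof.
apply/andP/andP => -[/eqP us /eqP->]; rewrite upd_same eqxx upd_upd -us upd_id.
  by rewrite eqxx.
by rewrite eqxx.
Qed.

Lemma covop_stE t a b : covop (covop_st t) a b = (covop t b a)^*.
Proof.
case: t => [[[s i] j]|[s k]] /=; last first.
  case: a b => [u'|[[s' k'] w']] [u|[[s1 k1] w]] /=; rewrite ?rmorph0 ?rmorph_nat //=.
  rewrite eq_sym; case: eqVneq => [[-> -> _]|_] //.
case: a b => [u'|[[s' k'] w']] [u|[[s1 k1] w]] /=; rewrite ?rmorph0 //.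
  by rewrite /xraise upd_swap rmorph_nat.
rewrite rmorphN rmorph_nat (andbC (s1 == s)) (eq_sym k1 k'); congr (- _%:R).
case: ifP => // /andP[_ /eqP->]; apply: eq_bigr => m _.
by rewrite upd_swap.
Qed.

(** Column coordinates are evaluated at a highest weight vector of an exterior power. *)
Definition spec_var (a : covar) : {mpoly C[#|X|]} :=
  match a with inl u => vr u | inr (s, k, w) => (eps k w)%:MP end.

Definition spec (p : {mpoly C[#|covar|]}) : {mpoly C[#|X|]} :=
  p \mPo [tuple spec_var (enum_val i) | i < #|covar|].

Arguments spec p : simpl never.

Lemma specD p q : spec (p + q) = spec p + spec q.
Proof. exact: raddfD. Qed.

Lemma spec_linear : linear spec.
Proof. by move=> c p q; rewrite /spec linearP. Qed.
HB.instance Definition _ :=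
  GRing.isLinear.Build C {mpoly C[#|covar|]} {mpoly C[#|X|]} *:%R spec spec_linear.

Lemma specM p q : spec (p * q) = spec p * spec q.
Proof. exact: rmorphM. Qed.

Lemma spec1 : spec 1 = 1.
Proof. exact: rmorph1. Qed.

Lemma spec_prod (T : finType) (P : pred T) (f : T -> {mpoly C[#|covar|]}) :
  spec (\prod_(i | P i) f i) = \prod_(i | P i) spec (f i).
Proof. exact: rmorph_prod. Qed.

Lemma spec_vr a : spec (vr a) = spec_var a.
Proof.
by rewrite /spec /vr comp_mpolyXU -tnth_nth tnth_mktuple enum_rankK.
Qed.

(** Applied to the difference of two derivations along [spec], this reduces [spec_raise] and
    [spec_diag] to a check on variables. *)
Lemma spec_derivation_eq0 (D : {linear {mpoly C[#|covar|]} -> {mpoly C[#|X|]}}) :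
  (forall p q, D (p * q) = D p * spec q + spec p * D q) ->
  (forall a, D (vr a) = 0) -> forall p, D p = 0.
Proof.
move=> DM D0 p; have D1 : D 1 = 0.
  by apply: (addIr (D 1)); rewrite add0r -{3}[1]mulr1 DM spec1 mulr1 mul1r.
rewrite [p]mpolyE linear_sum big1 // => m _; rewrite linearZ /=.
suff -> : D 'X_[m] = 0 by rewrite scaler0.
have [k] := ubnP (mdeg m); elim: k m => // k IHk m; rewrite ltnS => mk.
have [->|m0] := eqVneq m 0%MM; first by rewrite mpolyX0.
have [i mi] : exists i, m i != 0%N.
  apply/existsP; apply: contraNT m0; rewrite negb_exists => /forallP m0.
  by apply/eqP/mnmP => i; rewrite mnm0E; apply/eqP; move: (m0 i); rewrite negbK.
have mE : m = (m - U_(i) + U_(i))%MM by rewrite submK // lep1mP.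
rewrite mE mpolyXD DM -[i]enum_valK D0 mulr0 addr0 IHk ?mul0r //.
by apply: leq_trans mk; rewrite {2}mE mdegD mdeg1 addn1 enum_valK.
Qed.

Lemma sum_covar (T : nmodType) (F : covar -> T) :
  \sum_a F a = \sum_u F (inl u) + \sum_z F (inr z).
Proof. exact: big_sumType. Qed.

Lemma lvf_glact_x s i j u :
  lvf (glact s i j) (vr (inl u : covar)) = \sum_u' xraise s i j u' u *: vr (inl u' : covar).
Proof.
by rewrite lvf_vr sum_covar /= [X in _ + X]big1 ?addr0 // => z _; rewrite scale0r.
Qed.

Lemma lvf_glact_z s i j s1 k w :
  lvf (glact s i j) (vr (inr (s1, k, w) : covar)) =
  - (if s1 == s then \sum_(m : 'I_N | (m <= k)%N && (w m == i)) vr (inr (s1, k, upd w m j) : covar)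
     else 0).
Proof.
rewrite lvf_vr sum_covar /= big1 ?add0r => [|u _]; last by rewrite scale0r.
under eq_bigr => z _ do rewrite scaleNr.
rewrite sumrN; congr (- _); case: (eqVneq s1 s) => [->|ns]; last first.
  apply: big1 => -[[s' k'] w'] _ /=.
  by rewrite (negbTE ns) andbF scale0r.
transitivity (\sum_sk \sum_w' (zlower s i j (sk, w') (s, k, w))%:R *:
    vr (inr (sk, w') : covar)).
  by rewrite pair_big /=; apply: eq_bigr => -[sk w'].
rewrite (bigD1 (s, k)) //= [X in _ + X]big1 ?addr0; last first.
  move=> [s' k'] nsk; apply: big1 => w' _; rewrite /= eqxx andbT.
  by rewrite ifF ?scale0r //; apply: contraNF nsk => /andP[/eqP-> /eqP->].
rewrite !eqxx /= big_mkcondr /=.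
under eq_bigr => w' _ do rewrite natr_sum scaler_suml.
rewrite exchange_big /=; apply: eq_bigr => m mk.
case: eqP => [wm|_] /=; last by apply: big1 => w' _; rewrite scale0r.
rewrite (bigD1 (upd w m j)) //= eqxx scale1r big1 ?addr0 // => w' /negbTE->.
by rewrite scale0r.
Qed.

Lemma lvf_zdeg_vr s k a :
  lvf (zdeg s k) (vr a) =
  (match a with inl _ => false | inr (s1, k1, w) => (s1 == s) && (k1 == k) end)%:R *: vr a.
Proof.
rewrite lvf_vr (bigD1 a) //= big1 ?addr0 => [|b /negbTE ba].
  by case: a => [u|[[s1 k1] w]] //=; rewrite eqxx.
by case: a ba => [u|[[s1 k1] w]] /=; rewrite ?scale0r // => ->; rewrite scale0r.
Qed.

Lemma lvfC (A : finType) (L : A -> A -> C) c : lvf L c%:MP = 0.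
Proof. by rewrite -[c%:MP]mulr1 mul_mpolyC linearZ /= lvf1 scaler0. Qed.

(** On a column variable the right side differentiates a constant, and the left side vanishes by
    [eps_raise]; this is where [i < j] is used. *)
Lemma spec_raise s (i j : 'I_N) q : (i < j)%N ->
  spec (lvf (glact s i j) q) = lvf (xraise s i j) (spec q).
Proof.
move=> ij; pose D q := spec (lvf (glact s i j) q) - lvf (xraise s i j) (spec q).
have Dlin : linear D.
  move=> c x y; rewrite /D !linearP /= scalerBr scalerN.
  by rewrite addrACA.
pose Dl := GRing.isLinear.Build C _ _ _ D Dlin.
pose DL : {linear _ -> _} := HB.pack D Dl.
apply/eqP; rewrite -subr_eq0; apply/eqP; apply: (@spec_derivation_eq0 DL) => [x y|a] /=.
  rewrite /D !lvfM !specD !specM lvfM; ring.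
rewrite /D; case: a => [u|[[s1 k] w]].
  rewrite lvf_glact_x linear_sum spec_vr /= lvf_vr; apply/eqP; rewrite subr_eq0; apply/eqP.
  by apply: eq_bigr => u' _; rewrite linearZ /= spec_vr.
rewrite lvf_glact_z spec_vr /= lvfC subr0 linearN /=.
case: ifP => _; last by rewrite linear0 oppr0.
rewrite [spec (\sum_(_ | _) _)]linear_sum /=.
rewrite (eq_bigr (fun m => (eps k (upd w m j))%:MP)) => [|m _]; last first.
  by rewrite /= spec_vr.
by rewrite -raddf_sum /= eps_raise // mpolyC0 oppr0.
Qed.

(** E_ii multiplies a specialized column variable of length k + 1 by minus the number of letters
    [i], which is 1 or 0 according as [i <= k]; the degree operators make up for exactly this. An
    invariant therefore acquires the weight given by its column degrees. *)
Lemma spec_diag s (i : 'I_N) q :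
  lvf (xraise s i i) (spec q) =
  spec (lvf (glact s i i) q) + \sum_(k : 'I_N | (i <= k)%N) spec (lvf (zdeg s k) q).
Proof.
pose D q := spec (lvf (glact s i i) q) + \sum_(k : 'I_N | (i <= k)%N) spec (lvf (zdeg s k) q)
  - lvf (xraise s i i) (spec q).
have Dlin : linear D.
  move=> c x y; rewrite /D !linearP /= scalerBr scalerDr scalerN.
  rewrite [c *: \sum_(k : 'I_N | (i <= k)%N) _]scaler_sumr.
  rewrite (eq_bigr (fun k => c *: spec (lvf (zdeg s k) x) + spec (lvf (zdeg s k) y))).
    by rewrite big_split /= (AC (2 * 2 * 2) ((1 * 3 * 5) * (2 * 4 * 6))).
  by move=> k _; rewrite !linearP.
pose Dl := GRing.isLinear.Build C _ _ _ D Dlin.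
pose DL : {linear _ -> _} := HB.pack D Dl.
apply/esym/eqP; rewrite -subr_eq0; apply/eqP; apply: (@spec_derivation_eq0 DL) => [x y|a] /=.
  rewrite /D !lvfM !specD !specM lvfM.
  rewrite (eq_bigr (fun k => spec (lvf (zdeg s k) x) * spec y + spec x * spec (lvf (zdeg s k) y))).
    by rewrite big_split /= -mulr_suml -mulr_sumr; ring.
  by move=> k _; rewrite lvfM specD !specM.
rewrite /D; case: a => [u|[[s1 k] w]].
  rewrite [\sum_(k : 'I_N | (i <= k)%N) _]big1 ?addr0 => [|k _]; last first.
    by rewrite lvf_zdeg_vr scale0r linear0.
  rewrite lvf_glact_x [spec (\sum_(_ | _) _)]linear_sum spec_vr /= lvf_vr.
  apply/eqP; rewrite subr_eq0; apply/eqP.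
  by apply: eq_bigr => u' _; rewrite linearZ /= spec_vr.
rewrite lvf_glact_z spec_vr /= lvfC subr0 linearN /=.
rewrite [\sum_(k' : 'I_N | (i <= k')%N) _](eq_bigr (fun k' =>
    ((s1 == s) && (k == k'))%:R *: (eps k w)%:MP)) => [|k' _]; last first.
  by rewrite lvf_zdeg_vr linearZ /= spec_vr.
case: (eqVneq s1 s) => [->|_] /=; last first.
  by rewrite linear0 oppr0 add0r big1 // => k' _; rewrite scale0r.
have -> : spec (\sum_(m : 'I_N | (m <= k)%N && (w m == i)) vr (inr (s, k, upd w m i) : covar)) =
    \sum_(m : 'I_N | (m <= k)%N && (w m == i)) (eps k w)%:MP.
  rewrite [LHS]linear_sum; apply: eq_bigr => m /andP[_ /eqP wm].
  by rewrite /= spec_vr -wm upd_id.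
rewrite sumr_const.
have -> : \sum_(k' : 'I_N | (i <= k')%N) (k == k')%:R *: (eps k w)%:MP_[#|X|] =
    (i <= k)%:R *: (eps k w)%:MP.
  rewrite big_mkcond (bigD1 k) //= eqxx big1 ?addr0 => [|k' /negbTE kk'].
    by case: (i <= k)%N; rewrite ?scale0r ?scale1r.
  by rewrite eq_sym kk'; case: ifP; rewrite ?scale0r.
have [/eqP->|ew] := boolP (eps k w == 0); first by rewrite mpolyC0 mul0rn oppr0 scaler0 addr0.
by rewrite eps_diag // scaler_nat addNr.
Qed.

End Covariants.

(** * Columns of a Young diagram and products of column determinants *)

Lemma nth_ltn_count l c m : sorted geq l -> (c < nth 0 l m)%N = (m < count (fun a => c < a) l)%N.
Proof.
elim: l m => [|a l IHl] m; first by rewrite nth_nil.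
rewrite /= path_sortedE => [/andP[/allP al sl]|x y z xy yz]; last exact: leq_trans yz xy.
have [ca|ac] := ltnP c a; first by case: m => [|m] //=; rewrite IHl.
have -> : count (fun a => c < a)%N l = 0%N.
  apply/eqP; rewrite -leqn0 leqNgt -has_count; apply/hasPn => x /al /= xa.
  by rewrite -leqNgt (leq_trans xa).
rewrite /= add0n ltn0; apply/negbTE; rewrite -leqNgt; case: m => [|m] //=.
have [ml|/(nth_default 0%N)->//] := ltnP m (size l).
exact: leq_trans (al _ (mem_nth _ ml)) ac.
Qed.

(* The number of columns of length [k.+1]. *)
Definition colmult (l : seq nat) (k : nat) : nat := (nth 0 l k - nth 0 l k.+1)%N.

Section Columns.
Variables (N n : nat) (l : seq nat).
Hypotheses (l_part : is_partition l) (l_sum : sumn l = n) (l_size : (size l <= N.+1)%N).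
Notation C := algC.
Notation word := {ffun 'I_n -> 'I_N.+1}.
Notation ncol := (nth 0%N l 0).
Implicit Types (g : word).

Let l_sorted : sorted geq l. Proof. by case/andP: l_part. Qed.

(** The last row meeting column [c]; it is meaningful for nonempty columns only. *)
Definition kcol (c : nat) : 'I_N.+1 := inord (count (fun a => c < a)%N l).-1.

Lemma leq_kcol c m : (c < ncol)%N -> (m <= kcol c)%N = (c < nth 0 l m)%N.
Proof.
rewrite !nth_ltn_count // => c0.
rewrite /kcol inordK; first by case: (count _ _) c0.
by case: (count _ _) c0 (count_size (fun a => c < a)%N l) => //= k _ /leq_trans; apply.
Qed.

Lemma ccol_ltn (y : 'I_n) : (ccol l y < nth 0 l (crow l y))%N.
Proof. by apply: cell_ofP; rewrite l_sum. Qed.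

Lemma ccol_ncol (y : 'I_n) : (ccol l y < ncol)%N.
Proof. exact: leq_trans (ccol_ltn y) (nth_sorted_geq l_sorted _). Qed.

Definition hcol (y : 'I_n) : 'I_ncol := Ordinal (ccol_ncol y).

Definition hrow (y : 'I_n) : 'I_N.+1 := inord (crow l y).

Lemma hrowE y : hrow y = crow l y :> nat.
Proof. by rewrite inordK // (leq_trans (crow_size l_sum y)). Qed.

Lemma hrow_kcol y : (hrow y <= kcol (hcol y))%N.
Proof. by rewrite leq_kcol ?hrowE ?ccol_ltn // ccol_ncol. Qed.

Lemma sum_cells (V : nmodType) (G : 'I_ncol -> 'I_N.+1 -> V) :
  \sum_(c < ncol) \sum_(m : 'I_N.+1 | (m <= kcol c)%N) G c m = \sum_y G (hcol y) (hrow y).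
Proof.
rewrite pair_big_dep /=.
rewrite [RHS](partition_big (fun y => (hcol y, hrow y))
  (fun p : 'I_ncol * 'I_N.+1 => (p.2 <= kcol p.1)%N)) => [|y _]; last exact: hrow_kcol.
apply: eq_bigr => -[c m] /=; rewrite leq_kcol // => cm.
have [y0 [ry0 cy0]] := crowcol_surj l_sum cm.
have y0E : (hcol y0, hrow y0) = (c, m).
  by congr (_, _); apply: val_inj; rewrite /= ?hrowE.
rewrite (big_pred1 y0) => [|y]; first by case: y0E => -> ->.
rewrite -y0E xpair_eqE -!val_eqE /= !hrowE; apply/andP/eqP => [[/eqP cy /eqP ry]|-> //].
exact: crowcol_inj l_sum _ _ ry cy.
Qed.

(** Column [c] of the filling [g], read downwards. Below the column it is the identity, in
    accordance with [ext_word]; inside it [insub] always succeeds. *)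
Definition colword (c : nat) g : {ffun 'I_N.+1 -> 'I_N.+1} :=
  [ffun m : 'I_N.+1 => if (c < nth 0 l m)%N
                       then oapp g m (insub (cell_index l (m : nat, c))) else m].

Lemma colword_cell y g : colword (ccol l y) g (hrow y) = g y.
Proof.
rewrite ffunE hrowE ccol_ltn -[(crow l y, _)]surjective_pairing cell_ofK ?l_sum //.
by rewrite valK.
Qed.

Lemma colwordE c (m : 'I_N.+1) g : (c < nth 0 l m)%N ->
  exists y, [/\ hrow y = m, ccol l y = c & colword c g m = g y].
Proof.
move=> cm; have [y [ry cy]] := crowcol_surj l_sum cm.
have hy : hrow y = m by apply: val_inj; rewrite /= hrowE.
by exists y; split=> //; rewrite -cy -hy colword_cell.
Qed.

Lemma colword_upd c g y j : colword c (upd g y j) =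
  if ccol l y == c then upd (colword c g) (hrow y) j else colword c g.
Proof.
apply/ffunP => m; have [cm|mc] := boolP (c < nth 0 l m)%N; last first.
  rewrite ffunE (negbTE mc); case: eqP => [cy|_]; last by rewrite ffunE (negbTE mc).
  rewrite !ffunE (negbTE mc) ifF //; apply: contraNF mc => /eqP->.
  by rewrite -cy hrowE ccol_ltn.
have [x [hx cx _]] := colwordE g cm.
rewrite -{1}cx -hx colword_cell ffunE -cx; case: (eqVneq x y) => [->|xy].
  by rewrite eqxx upd_same.
case: eqP => [cy|_]; last by rewrite colword_cell.
rewrite ffunE ifF ?colword_cell //; apply: contra_neqF xy => /eqP hxy.
apply: (crowcol_inj l_sum) => //.
by rewrite -!hrowE hxy.
Qed.

Lemma colmultE (k : 'I_N.+1) : colmult l k = #|[pred c : 'I_ncol | kcol c == k]|.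
Proof.
have cnt a : (a <= ncol)%N -> a = (\sum_(c < ncol) (c < a))%N.
  move=> an; transitivity (\sum_(c < a) 1)%N; first by rewrite sum1_card card_ord.
  rewrite (big_ord_widen _ (fun=> 1%N) an) big_mkcond; by apply: eq_bigr => c _; case: ltnP.
have le m : (nth 0 l m <= ncol)%N by apply: nth_sorted_geq.
rewrite /colmult {1}(cnt _ (le k)) {1}(cnt _ (le k.+1)) -sum1_card [X in _ = X]big_mkcond.
rewrite (eq_bigr (fun c : 'I_ncol => ((c < nth 0 l k.+1) + (kcol c == k))%N)) => [|c _].
  rewrite big_split addKn; apply: eq_bigr => c _; rewrite inE.
  by case: eqP.
have cE m : (c < nth 0 l m)%N = (m <= kcol c)%N by rewrite leq_kcol.
by rewrite !cE -val_eqE /= [(k <= _)%N]leq_eqVlt eq_sym; case: ltngtP.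
Qed.

Lemma sum_colmult (i : 'I_N.+1) :
  (\sum_(k : 'I_N.+1 | (i <= k)%N) colmult l k)%N = nth 0%N l i.
Proof.
transitivity (\sum_(k : 'I_N.+1 | (i <= k)%N) \sum_(c < ncol) (kcol c == k))%N.
  apply: eq_bigr => k _; rewrite colmultE -sum1_card big_mkcond; apply: eq_bigr => c _.
  by rewrite inE; case: eqP.
rewrite exchange_big /=.
rewrite (eq_bigr (fun c : 'I_ncol => nat_of_bool (c < nth 0 l i)%N)) => [|c _].
  have an : (nth 0 l i <= ncol)%N by apply: nth_sorted_geq.
  transitivity (\sum_(c < nth 0 l i) 1)%N; last by rewrite sum1_card card_ord.
  by rewrite (big_ord_widen _ (fun=> 1%N) an) [RHS]big_mkcond; apply: eq_bigr => c _; case: ltnP.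
rewrite -leq_kcol // big_mkcond (bigD1 (kcol c)) //= eqxx big1 ?addn0.
  by case: (_ <= _)%N.
by move=> k kc; rewrite eq_sym (negbTE kc) if_same.
Qed.

(** The counterpart of [young_vec] for [N.+1] letters: the tensor product of the vectors e_0 /\ ...
    /\ e_k over all columns. *)
Definition coldet g : C := \prod_(c < ncol) eps (kcol c) (colword c g).

Section Covariant.
Variables (I : finType) (s : I).

Definition colprod g : {mpoly C[#|covar I N.+1|]} :=
  \prod_(c < ncol) vr (inr (s, kcol c, colword c g) : covar I N.+1).

Lemma spec_colprod g : spec (colprod g) = (coldet g)%:MP.
Proof.
by rewrite spec_prod rmorph_prod; apply: eq_bigr => c _; rewrite spec_vr.
Qed.

Lemma lvf_glact_colprod i j g :
  lvf (glact s i j) (colprod g) = - \sum_(y | g y == i) colprod (upd g y j).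
Proof.
rewrite lvf_prod.
rewrite (eq_bigr (fun c : 'I_ncol => - \sum_(m : 'I_N.+1 | (m <= kcol c)%N)
  if colword c g m == i then vr (inr (s, kcol c, upd (colword c g) m j) : covar I N.+1) *
    \prod_(c' | c' != c) vr (inr (s, kcol c', colword c' g) : covar I N.+1) else 0)).
  rewrite sumrN sum_cells; congr (- _); rewrite [RHS]big_mkcond; apply: eq_bigr => y _.
  rewrite colword_cell; case: eqP => // _; rewrite /colprod [RHS](bigD1 (hcol y)) //=.
  rewrite colword_upd eqxx; congr (_ * _); apply: eq_bigr => c cy.
  by rewrite colword_upd ifF // eq_sym; apply: negbTE; rewrite -val_eqE in cy.
move=> c _; rewrite lvf_glact_z eqxx mulNr mulr_suml; congr (- _).
by rewrite -big_mkcondr.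
Qed.

Lemma lvf_glact_colprod_neq s' i j g : s' != s -> lvf (glact s' i j) (colprod g) = 0.
Proof.
move=> ss'; rewrite lvf_prod big1 // => c _.
by rewrite lvf_glact_z eq_sym (negbTE ss') oppr0 mul0r.
Qed.

Lemma lvf_zdeg_colprod s' k g :
  lvf (zdeg s' k) (colprod g) = (if s == s' then colmult l k else 0%N)%:R *: colprod g.
Proof.
rewrite lvf_prod (eq_bigr (fun c : 'I_ncol => ((s == s') && (kcol c == k))%:R *: colprod g)).
  rewrite -scaler_suml -natr_sum; congr (_%:R *: _); case: eqP => _ /=; last by rewrite big1.
  rewrite colmultE -sum1_card [RHS]big_mkcond; apply: eq_bigr => c _.
  by rewrite inE; case: eqP.
move=> c _; rewrite lvf_zdeg_vr -scalerAl; congr (_ *: _).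
by rewrite /colprod [RHS](bigD1 c).
Qed.

End Covariant.

Lemma coldet_row : coldet (finfun hrow) = 1.
Proof.
apply: big1 => c _; rewrite (_ : colword c _ = [ffun m => m]) ?eps_id //.
apply/ffunP => m; have [cm|mc] := boolP (c < nth 0 l m)%N; last by rewrite !ffunE (negbTE mc).
by have [y [hy _ ->]] := colwordE (finfun hrow) cm; rewrite !ffunE.
Qed.

(** With a single factor, [coldet g] is the specialization of the monomial [colprod] of [g]. Being a
    constant it is killed by every vector field, and [spec_raise] and [spec_diag] turn this into the
    two highest weight conditions. *)
Lemma coldet_hwv : hwv (nth 0%N l) coldet.
Proof.
pose Y g := colprod (tt : unit) g.
have specY i j g : spec (lvf (glact tt i j) (Y g)) =
    (- \sum_(y | g y == i) coldet (upd g y j))%:MP_[#|{ffun unit -> 'I_N.+1}|].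
  rewrite lvf_glact_colprod linearN /= [spec (\sum_(_ | _) _)]linear_sum rmorphN rmorph_sum.
  by congr (- _); apply: eq_bigr => y _; rewrite /= spec_colprod.
split=> [g g0 i|i j ij g]; last first.
  have := spec_raise tt (Y g) ij; rewrite specY spec_colprod lvfC => /eqP.
  by rewrite mpolyC_eq0 oppr_eq0 => /eqP.
have := spec_diag tt i (Y g); rewrite specY spec_colprod lvfC.
rewrite (eq_bigr (fun k : 'I_N.+1 => (colmult l k)%:R *: (coldet g)%:MP)) => [|k _].
  rewrite -scaler_suml -natr_sum sum_colmult -mul_mpolyC -rmorphM -rmorphD => /esym/eqP.
  rewrite mpolyC_eq0 (eq_bigr (fun=> coldet g)) => [|y /eqP <-]; last by rewrite upd_id.
  rewrite sumr_const -[coldet g *+ _]mulr_natl -mulNr -mulrDl mulf_eq0 (negbTE g0) orbF.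
  by rewrite addrC subr_eq0 eqr_nat => /eqP->.
by rewrite lvf_zdeg_colprod eqxx linearZ /= spec_colprod.
Qed.

End Columns.

(** * Highest weight polynomials as specializations of invariants *)

Section CovariantSurjection.
Variables (I : finType) (N n : nat) (la : I -> seq nat).
Hypotheses (la_part : forall s, is_partition (la s)) (la_sum : forall s, sumn (la s) = n).
Hypothesis la_size : forall s, (size (la s) <= N.+1)%N.
Notation C := algC.
Notation X := {ffun I -> 'I_N.+1}.
Notation mword := {ffun 'I_n -> X}.

Definition cov_weight (c : I -> nat -> nat) (t : covop_index I N.+1) : C :=
  match t with inl _ => 0 | inr (s, k) => (c s k)%:R end.

Definition cov_eigen c (q : {mpoly C[#|covar I N.+1|]}) : Prop :=
  eigen (@covop I N.+1) (cov_weight c) q.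

Lemma spec_cov_eigen q : cov_eigen (fun s => colmult (la s)) q ->
  hwp (fun s => nth 0%N (la s)) (spec q).
Proof.
move=> hq; split=> [s i j ij|s i].
  by rewrite -spec_raise // (hq (inl (s, i, j))) scale0r linear0.
rewrite spec_diag (hq (inl (s, i, i))) scale0r linear0 add0r.
rewrite (eq_bigr (fun k : 'I_N.+1 => (colmult (la s) k)%:R *: spec q)) => [|k _].
  by rewrite -scaler_suml -natr_sum (sum_colmult (la_part s) (la_size s)).
by rewrite (hq (inr (s, k))) linearZ.
Qed.

Definition xword (f : mword) : {mpoly C[#|covar I N.+1|]} :=
  \prod_x vr (inl (f x) : covar I N.+1).

Definition zword (t : {ffun I -> 'S_n}) (f : mword) : {mpoly C[#|covar I N.+1|]} :=
  \prod_s colprod (la s) s (pact (swap f s) (t s)).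

(* The contraction of the tensor variables [inl u] along all columns of the tableaux of
   shapes [la s] filled according to [t]; it is invariant under the product of the gl_N,
   and its specialization is the polynomial attached to a product of column determinants. *)
Definition contraction t := \sum_(f : mword) xword f * zword t f.

Lemma lvf_xword s i j f : lvf (glact s i j) (xword f) =
  \sum_(x | swap f s x == j) xword (upd f x (upd (f x) s i)).
Proof.
rewrite lvf_prod [RHS]big_mkcond; apply: eq_bigr => x _; rewrite lvf_glact_x !ffunE.
rewrite /xraise; case: eqP => fx; last first.
  by rewrite big1 ?mul0r // => u' _; rewrite scale0r.
rewrite (bigD1 (upd (f x) s i)) //= eqxx scale1r big1 ?addr0 => [|u' /negbTE->]; last first.
  by rewrite scale0r.
rewrite /xword [RHS](bigD1 x) //= upd_same; congr (_ * _); apply: eq_bigr => y yx.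
by rewrite ffunE (negbTE yx).
Qed.

Lemma lvf_zword s i j t f : lvf (glact s i j) (zword t f) =
  - \sum_(x | swap f s x == i) zword t (upd f x (upd (f x) s j)).
Proof.
rewrite lvf_prod (bigD1 s) //= [X in _ + X]big1 ?addr0 => [|s' s's]; last first.
  by rewrite lvf_glact_colprod_neq ?mul0r // eq_sym.
rewrite (lvf_glact_colprod (la_part s) (la_sum s) (la_size s)) mulNr mulr_suml; congr (- _).
rewrite [RHS](reindex_inj (@perm_inj _ (t s))) /=; apply: eq_big => [x|x _].
  by rewrite ffunE.
rewrite /zword [RHS](bigD1 s) //= swap_upd upd_same upd_pact; congr (_ * _).
by apply: eq_bigr => s' s's; rewrite [upd _ _ _ s']ffunE (negbTE s's).
Qed.

(** The action on the tensor variables and the dual action on the column variables cancel: changing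
    one letter from [j] to [i] matches the terms of the two sums. *)
Lemma contraction_eigen t : cov_eigen (fun s => colmult (la s)) (contraction t).
Proof.
case=> [[[s i] j]|[s k]] /=; last first.
  rewrite linear_sum scaler_sumr; apply: eq_bigr => f _ /=; rewrite lvfM.
  rewrite [lvf _ (xword f)]lvf_prod big1 ?mul0r ?add0r => [|x _]; last first.
    by rewrite lvf_zdeg_vr scale0r mul0r.
  rewrite [lvf _ (zword t f)]lvf_prod (bigD1 s) //=.
  rewrite [X in _ * (_ + X)]big1 ?addr0 => [|s' s's]; last first.
    rewrite (lvf_zdeg_colprod (la_part s') (la_size s')) (negbTE s's).
    by rewrite scale0r mul0r.
  rewrite (lvf_zdeg_colprod (la_part s) (la_size s)) eqxx -scalerAl -scalerAr.
  by rewrite /zword [in RHS](bigD1 s).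
rewrite scale0r linear_sum /=.
rewrite (eq_bigr (fun f => \sum_(x | swap f s x == j) xword (upd f x (upd (f x) s i)) * zword t f
  - \sum_(x | swap f s x == i) xword f * zword t (upd f x (upd (f x) s j)))) => [|f _]; last first.
  by rewrite lvfM lvf_xword lvf_zword mulr_suml mulrN mulr_sumr.
rewrite sumrB; apply/eqP; rewrite subr_eq0; apply/eqP.
rewrite (exchange_big_dep xpredT) //= [RHS](exchange_big_dep xpredT) //=.
apply: eq_bigr => x _; under eq_bigl do rewrite !ffunE; under [RHS]eq_bigl do rewrite !ffunE.
rewrite (reindex_onto (fun f : mword => upd f x (upd (f x) s j))
  (fun f => upd f x (upd (f x) s i))) /=; last first.
  by move=> f /eqP fx; rewrite upd_same !upd_upd -fx !upd_id.
apply: eq_big => [f|f /andP[_ /eqP fE]]; last by rewrite {1}fE.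
rewrite !upd_same eqxx /= upd_upd upd_upd; apply/eqP/eqP => [fE|fx].
  by rewrite -fE !upd_same.
by rewrite -fx !upd_id.
Qed.

Lemma spec_contraction t : spec (contraction t) =
  wpoly (fun f : mword => \prod_s coldet (la s) (pact (swap f s) (t s))).
Proof.
rewrite [LHS]linear_sum; apply: eq_bigr => f _; rewrite /= specM !spec_prod mulrC.
rewrite -mul_mpolyC rmorph_prod; congr (_ * _); apply: eq_bigr => y _.
  exact: spec_colprod.
exact: spec_vr.
Qed.

Lemma cov_eigen_lin c (T : finType) (a : T -> C) (q : T -> {mpoly C[#|covar I N.+1|]}) :
  (forall k, cov_eigen c (q k)) -> cov_eigen c (\sum_k a k *: q k).
Proof.
move=> hq t; rewrite linear_sum scaler_sumr; apply: eq_bigr => k _ /=.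
by rewrite linearZ /= hq !scalerA mulrC.
Qed.

(** Reproducing each slot by translates of [coldet] and expanding the product over the slots writes
    [p] as a combination of the polynomials of [spec_contraction]. *)
Lemma spec_surj (s0 : I) p : hwp (fun s => nth 0%N (la s)) p ->
  exists2 q, cov_eigen (fun s => colmult (la s)) q & spec q = p.
Proof.
move=> hp; have pn : forall m, p@_m != 0 -> mdeg m = n.
  by apply: (hwp_homog (s := s0)) hp; rewrite sum_nth_sumn.
have [v vinv pE] := wpoly_surj pn.
pose w (h : {ffun I -> {ffun 'I_n -> 'I_N.+1}}) := v (unswap h).
have winv (s : 'S_n) (h : {ffun I -> {ffun 'I_n -> 'I_N.+1}}) : w [ffun i => pact (h i) s] = w h.
  rewrite /w -[RHS](vinv s); congr v.
  by apply/ffunP => t; apply/ffunP => y; rewrite !ffunE.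
have pE' : p = wpoly (w \o @swap I N.+1 n).
  by rewrite pE; apply: eq_bigr => g _; rewrite /= /w swapK.
have [_ wsl] : tensor_hwv (fun s => nth 0%N (la s)) w by apply/hwp_wpoly => //; rewrite -pE'.
have repro s : exists2 c, c != 0 & forall u, hwv (nth 0%N (la s)) u ->
    forall f, orbit_kernel (@coldet N n (la s)) u f = c * u f.
  apply: (hwv_reproducing (f0 := finfun (hrow N (la s))))
    (coldet_hwv (la_part s) (la_sum s) (la_size s)) _.
  by rewrite (coldet_row (la_sum s) (la_size s)) oner_neq0.
have /fin_all_exists[c cP] : forall s, exists c : C, c != 0 /\
    forall u, hwv (nth 0%N (la s)) u ->
    forall f, orbit_kernel (@coldet N n (la s)) u f = c * u f.
  by move=> s; have [c] := repro s; exists c.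
pose b s (g : {ffun 'I_n -> 'I_N.+1}) (t : 'S_n) := (c s)^-1 * (coldet (la s) (pact g t))^*.
pose Pi s (g f : {ffun 'I_n -> 'I_N.+1}) := \sum_(t : 'S_n) b s g t * coldet (la s) (pact f t).
have wE h : w h = \sum_h' w h' * \prod_s Pi s (h' s) (h s).
  apply: tensor_reproduce => s {}h; have [c0 cE] := cP s.
  rewrite -{1}(upd_id h s); apply: (mulfI c0).
  rewrite -(cE (fun g => w (upd h s g)) (wsl s h)) /orbit_kernel /orbit_coef mulr_sumr.
  under eq_bigr => t _ do rewrite mulr_suml.
  rewrite exchange_big; apply: eq_bigr => g _ /=; rewrite mulrCA; rewrite mulr_sumr mulr_sumr.
  by apply: eq_bigr => t _; rewrite /b -[(c s)^-1 * _ * _]mulrA mulVKf // mulrA.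
pose coef (k : {ffun I -> {ffun 'I_n -> 'I_N.+1}} * {ffun I -> 'S_n}) :=
  w k.1 * \prod_s b s (k.1 s) (k.2 s).
exists (\sum_k coef k *: contraction k.2).
  by apply: cov_eigen_lin => k; apply: contraction_eigen.
rewrite pE' linear_sum.
rewrite (eq_bigr (fun k => coef k *: wpoly (fun f : mword =>
  \prod_s coldet (la s) (pact (swap f s) (k.2 s))))) => [|k _]; last first.
  by rewrite linearZ /= spec_contraction.
rewrite /wpoly; under eq_bigr => k _ do rewrite scaler_sumr.
rewrite exchange_big; apply: eq_bigr => f _ /=.
under eq_bigr => k _ do rewrite scalerA.
rewrite -scaler_suml; congr (_ *: _); rewrite wE -(pair_big xpredT xpredT (fun h t =>
  coef (h, t) * \prod_s coldet (la s) (pact (swap f s) (t s)))) /=.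
apply: eq_bigr => h _; rewrite /Pi bigA_distr_bigA mulr_sumr; apply: eq_bigr => t _.
by rewrite /coef /= -mulrA -big_split.
Qed.

End CovariantSurjection.

(** * Stability *)

Lemma nth_padd l m i : nth 0%N (padd l m) i = (nth 0 l i + nth 0 m i)%N.
Proof.
by elim: l m i => [|x l IHl] [|y m] [|i] //=; rewrite ?nth_nil ?addn0 // IHl.
Qed.

Lemma size_padd l m : size (padd l m) = maxn (size l) (size m).
Proof. by elim: l m => [|x l IHl] [|y m] //=; rewrite ?max0n ?maxn0 // IHl maxnSS. Qed.

Lemma nth_pscale d l i : nth 0%N (pscale d l) i = (d * nth 0 l i)%N.
Proof.
have [li|il] := ltnP i (size l); first by rewrite (nth_map 0%N).
by rewrite !nth_default ?muln0 // size_map.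
Qed.

Lemma sumn_padd l m : sumn (padd l m) = (sumn l + sumn m)%N.
Proof. by elim: l m => [|x l IHl] [|y m] //=; rewrite ?addn0 // IHl addnACA. Qed.

Lemma sumn_pscale d l : sumn (pscale d l) = (d * sumn l)%N.
Proof. by elim: l => [|x l /= ->]; rewrite ?muln0 // mulnDr. Qed.

Lemma pscale1 l : pscale 1 l = l.
Proof. by rewrite /pscale (eq_map mul1n) map_id. Qed.

Lemma is_partitionP l :
  reflect ((forall i, nth 0 l i.+1 <= nth 0 l i)%N /\ forall i, (i < size l)%N -> (0 < nth 0 l i)%N)
    (is_partition l).
Proof.
apply: (iffP andP) => [[sl /(all_nthP 0%N) pos]|[sl pos]].
  by split=> // i; apply: nth_sorted_geq.
by split; [apply/(sortedP 0%N) => i _; apply: sl | apply/(all_nthP 0%N)].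
Qed.

Lemma is_partition_pscale d l : (0 < d)%N -> is_partition l -> is_partition (pscale d l).
Proof.
move=> d0 /is_partitionP[sl pos]; apply/is_partitionP; split=> i; rewrite !nth_pscale.
  by rewrite leq_mul2l sl orbT.
by rewrite size_map muln_gt0 d0 => /pos.
Qed.

Lemma is_partition_padd l m : is_partition l -> is_partition m -> is_partition (padd l m).
Proof.
move=> /is_partitionP[sl pl] /is_partitionP[sm pm]; apply/is_partitionP; split=> i.
  by rewrite !nth_padd leq_add.
by rewrite size_padd nth_padd leq_max => /orP[/pl|/pm]; lia.
Qed.

Lemma colmult_padd l m k : is_partition l -> is_partition m ->
  colmult (padd l m) k = (colmult l k + colmult m k)%N.
Proof.
move=> /is_partitionP[sl _] /is_partitionP[sm _]; rewrite /colmult !nth_padd.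
by have := sl k; have := sm k; lia.
Qed.

Lemma colmult_pscale d l k : colmult (pscale d l) k = (d * colmult l k)%N.
Proof. by rewrite /colmult !nth_pscale mulnBr. Qed.

Lemma eventually_constant (r : nat -> nat) d0 B :
  (forall d, (d0 <= d)%N -> (r d <= r d.+1)%N) -> (forall d, (d0 <= d)%N -> (r d <= B)%N) ->
  exists2 D, (d0 <= D)%N & forall d, (D <= d)%N -> r d = r D.
Proof.
move=> incr bnd; have [k] := ubnP (B - r d0)%N.
elim: k d0 incr bnd => // k IHk d0 incr bnd; rewrite ltnS => Bk.
have mono d : (d0 <= d)%N -> (r d0 <= r d)%N.
  elim: d => [|d IHd]; first by rewrite leqn0 => /eqP->.
  rewrite leq_eqVlt => /orP[/eqP->//|]; rewrite ltnS => dd.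
  exact: leq_trans (IHd dd) (incr _ dd).
have [[d [dd rd]]|no] := classic (exists d, (d0 <= d)%N /\ r d != r d0); last first.
  exists d0 => // d dd; apply/eqP/idPn => rd; by apply: no; exists d.
have [||| D DD cD] := IHk d.
- by move=> e de; apply: incr; apply: leq_trans de.
- by move=> e de; apply: bnd; apply: leq_trans de.
- by have := mono _ dd; have := bnd _ dd; move: rd; lia.
by exists D => //; apply: leq_trans DD.
Qed.

Lemma kron_has_dim N a b c : is_partition a -> is_partition b -> is_partition c ->
  sumn a = sumn b -> sumn b = sumn c ->
  (size a <= N.+1)%N -> (size b <= N.+1)%N -> (size c <= N.+1)%N ->
  has_dim (@hwp _ N.+1 (fun s => nth 0%N (triple a b c s)))
    (\rank (kron_proj (sumn a) (triple a b c))).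
Proof.
move=> pa pb pc ab bc sa sb sc; apply: has_dim_hwp; first exact: ord0.
- exact: (@tripleP is_partition).
- by apply: (@tripleP (fun l => sumn l = sumn a)); rewrite ?ab ?bc.
- exact: (@tripleP (fun l => size l <= N.+1)%N).
Qed.

Section Boundedness.
Variables (I : finType) (s0 : I) (N : nat) (la al : I -> seq nat).
Variables (n k : nat).
Hypotheses (la_part : forall s, is_partition (la s)) (al_part : forall s, is_partition (al s)).
Hypotheses (la_sum : forall s, sumn (la s) = n) (al_sum : forall s, sumn (al s) = k).
Hypotheses (la_size : forall s, (size (la s) <= N.+1)%N).
Hypotheses (al_size : forall s, (size (al s) <= N.+1)%N).
Notation HW l := (@hwp I N.+1 (fun s => nth 0%N (l s))).

Let shifted d s := padd (la s) (pscale d (al s)).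

Lemma hwp_bounded : (forall d, (0 < d)%N -> has_dim (HW (fun s => pscale d (al s))) 1) ->
  exists B d0, forall d r, (d0 <= d)%N -> has_dim (HW (shifted d)) r -> (r <= B)%N.
Proof.
move=> dim1; pose cw d s j := (colmult (la s) j + d * colmult (al s) j)%N.
(* One ideal for all [d] at once: neither its generators nor the bound depend on [d]. *)
pose S (q : {mpoly algC[#|covar I N.+1|]}) := exists d, cov_eigen (cw d) q.
have [l [lS lP]] := hilbert_basis S.
have /fin_all_exists[e eP] : forall i : 'I_(size l), exists d, cov_eigen (cw d) l`_i.
  by move=> i; apply: lS; apply: mem_nth.
have dim1' d : exists f, (0 < d)%N ->
    forall p, HW (fun s => pscale d (al s)) p -> exists c, p = c *: f.
  case: d => [|d]; first by exists 0.
  have [//|f [_ _ fP]] := dim1 d.+1; exists (f 0) => _ p /fP[c ->].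
  by exists (c 0); rewrite big_ord1.
(* Beyond this threshold every [d - e i] is positive, as weak stability requires. *)
exists (size l), (\max_i e i).+1 => d r dmax hd.
have ltd i : (e i < d)%N by apply: leq_trans dmax; rewrite ltnS (leq_bigmax i).
have d_gt0 : (0 < d)%N by apply: leq_trans dmax.
have /fin_all_exists[f fP] := fun i : 'I_(size l) => dim1' (d - e i)%N.
apply: (has_dim_leq_span (b := fun i : 'I_(size l) => f i * spec l`_i) hd) => p hp.
have part s : is_partition (shifted d s).
  by rewrite is_partition_padd // is_partition_pscale.
have sum s : sumn (shifted d s) = (n + d * k)%N.
  by rewrite sumn_padd sumn_pscale la_sum al_sum.
have szle s : (size (shifted d s) <= N.+1)%N.
  by rewrite size_padd size_map geq_max la_size al_size.
have [q qeig qp] := spec_surj part sum szle s0 hp.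
have {}qeig : cov_eigen (cw d) q.
  move=> t; rewrite qeig; congr (_ *: _); case: t => // -[s j] /=.
  by rewrite colmult_padd ?colmult_pscale // is_partition_pscale.
have [a qE] := in_ideal_seqP (lP q (in_ideal_gen (ex_intro _ d qeig))).
have wok c : weight_ok (@covop_st I N.+1) (@cov_weight I N c).
  by case=> [[[s i] j]|[s i]] /=; rewrite ?rmorph0 ?rmorph_nat.
have [b [beig qb]] := eigen_coefficients (@covop_stE I N.+1) (wok (cw d))
  (fun i => wok (cw (e i))) qeig eP qE.
have /fin_all_exists[c cP] : forall i, exists c, spec (b i) = c *: f i.
  move=> i; apply: fP; first by rewrite subn_gt0.
  apply: spec_cov_eigen.
  - by move=> s; rewrite is_partition_pscale // subn_gt0.
  - by move=> s; rewrite size_map.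
  - move=> t; rewrite beig; congr (_ *: _); case: t => [[[s i'] j]|[s j]] /=.
      by rewrite subrr.
    (* The contribution of [la] cancels, leaving the weight of a pure multiple of [al]. *)
    rewrite colmult_pscale /cw -natrB; last by rewrite leq_add2l leq_mul2r ltnW ?orbT.
    by rewrite subnDl mulnBl.
exists c; rewrite -qp qb linear_sum; apply: eq_bigr => i _ /=.
by rewrite specM cP scalerAl.
Qed.

Lemma hwp_increasing d r r' :
  (exists2 f, f != 0 & HW al f) ->
  has_dim (HW (shifted d)) r -> has_dim (HW (shifted d.+1)) r' -> (r <= r')%N.
Proof.
move=> [f f0 hf]; apply: (has_dim_inj (f := fun p => p * f)) => [a x y||x hx|x _ /eqP].
- by rewrite mulrDl scalerAl.
- exact: subspace_hwp.
- apply: eq_hwp (hwpM hx hf) => s i.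
  by rewrite !nth_padd !nth_pscale mulSn addnA addnAC.
- by rewrite mulf_eq0 (negbTE f0) orbF => /eqP.
Qed.

End Boundedness.

Theorem theorem1p2 (a b c : seq nat) :
  is_partition a -> is_partition b -> is_partition c ->
  sumn a = sumn b -> sumn b = sumn c ->
  weakly_stable a b c -> stable a b c.
Proof.
move=> pa pb pc ab bc ws; split.
  by have := ws 1%N isT; rewrite !pscale1 => ->; apply: ltr01.
move=> la mu nu pla pmu pnu lm mn.
(* Scaling by [d > 0] does not change the number of parts, so one [N] serves all [d]. *)
pose N := (size a + size b + size c + size la + size mu + size nu)%N.
pose L d := triple (padd la (pscale d a)) (padd mu (pscale d b)) (padd nu (pscale d c)).
pose r d := \rank (kron_proj (sumn (padd la (pscale d a))) (L d)).
have al_part : forall s, is_partition (triple a b c s) by apply: (@tripleP is_partition).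
have la_part : forall s, is_partition (triple la mu nu s) by apply: (@tripleP is_partition).
have LE d s : L d s = padd (triple la mu nu s) (pscale d (triple a b c s)).
  by case: s => -[|[|[|]]].
have kronE d : (0 < d)%N ->
    kron (padd la (pscale d a)) (padd mu (pscale d b)) (padd nu (pscale d c)) = (r d)%:R.
  move=> d0; apply: kron_rank; rewrite ?sumn_padd ?sumn_pscale ?lm ?mn ?ab ?bc //;
  by rewrite is_partition_padd // is_partition_pscale.
have dimL d : (0 < d)%N -> has_dim (@hwp _ N.+1 (fun s => nth 0%N
    (padd (triple la mu nu s) (pscale d (triple a b c s))))) (r d).
  move=> d0; have hd : has_dim (@hwp _ N.+1 (fun s => nth 0%N (L d s))) (r d).
    apply: kron_has_dim; rewrite ?sumn_padd ?sumn_pscale ?lm ?mn ?ab ?bc //;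
    rewrite ?is_partition_padd ?is_partition_pscale // ?size_padd ?size_map /N; lia.
  by case: hd => B [BL Bi Bs]; exists B; split=> // [i|p hp]; [apply: eq_hwp (BL i) |
    apply: Bs; apply: eq_hwp hp] => s j; rewrite LE.
have dim1 d : (0 < d)%N ->
    has_dim (@hwp _ N.+1 (fun s => nth 0%N (pscale d (triple a b c s)))) 1.
  move=> d0; pose ad := triple (pscale d a) (pscale d b) (pscale d c).
  have adE s : ad s = pscale d (triple a b c s) by case: s => -[|[|[|]]].
  have hd : has_dim (@hwp _ N.+1 (fun s => nth 0%N (ad s))) 1.
    have rk : \rank (kron_proj (sumn (pscale d a)) ad) = 1%N.
      apply/eqP; rewrite -(pnatr_eq1 algC) -kron_rank ?is_partition_pscale //.
      - by rewrite ws.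
      - by rewrite !sumn_pscale ab.
      - by rewrite !sumn_pscale bc.
    rewrite -[X in has_dim _ X]rk.
    apply: kron_has_dim; rewrite ?is_partition_pscale ?sumn_pscale ?ab ?bc //;
    rewrite size_map /N; lia.
  by case: hd => B [BL Bi Bs]; exists B; split=> // [i|p hp]; [apply: eq_hwp (BL i) |
    apply: Bs; apply: eq_hwp hp] => s j; rewrite adE.
have [B [d0 bnd]] : exists B d0, forall d r, (d0 <= d)%N -> has_dim (@hwp _ N.+1 (fun s =>
    nth 0%N (padd (triple la mu nu s) (pscale d (triple a b c s))))) r -> (r <= B)%N.
  apply: (@hwp_bounded _ (ord0 : 'I_3) N (triple la mu nu) (triple a b c) (sumn la) (sumn a)) => //.
  - by apply: (@tripleP (fun l => sumn l = sumn la)); rewrite ?lm ?mn.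
  - by apply: (@tripleP (fun l => sumn l = sumn a)); rewrite ?ab ?bc.
  - by apply: (@tripleP (fun l => size l <= N.+1)%N); rewrite /N; lia.
  - by apply: (@tripleP (fun l => size l <= N.+1)%N); rewrite /N; lia.
have [f f0 hf] : exists2 f, f != 0 & @hwp _ N.+1 (fun s => nth 0%N (triple a b c s)) f.
  have [f [hf find _]] := dim1 1%N isT; exists (f 0).
    apply/eqP => f00; have := find (fun=> 1); rewrite big_ord1 scale1r => /(_ f00 0)/eqP.
    by rewrite oner_eq0.
  by apply: eq_hwp (hf 0) => s j; rewrite pscale1.
(* The value [d = 0] is excluded because [pscale 0 a] consists of zeros, which are not parts of a
   partition. *)
have [D dD rD] : exists2 D, (maxn 1 d0 <= D)%N & forall d, (D <= d)%N -> r d = r D.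
  apply: (@eventually_constant r _ B) => d; rewrite geq_max => /andP[d1 dd0].
    apply: (@hwp_increasing _ N (triple la mu nu) (triple a b c) d) (dimL d d1) _.
      by exists f.
    exact: dimL.
  exact: bnd dd0 (dimL d d1).
have D0 : (0 < D)%N by move: dD; rewrite geq_max => /andP[].
by exists D => d Dd; rewrite !kronE ?rD // (leq_trans D0).
Qed.
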